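(* Let $\Gamma=\mathbb{Z}\omega_1+\mathbb{Z}\omega_2$ be a full-rank lattice in $\mathbb{C}$, $\nu>0$, and let $\chi$ be a pseudo-character on $\Gamma$ (relative to $\nu$). Then for all $z,w\in\mathbb{C}$ the kernel function $K^{\nu}_{\Gamma,\chi}$ has the power series expansion $$K^{\nu}_{\Gamma,\chi}(z,w)=\frac{\nu}{\pi}\sum_{m,n=0}^{\infty}(-1)^m a_{m,n}(\Gamma|\nu,\chi)\,\frac{z^n\overline{w}^m}{m!\,n!},\qquad a_{m,n}(\Gamma|\nu,\chi):=\sum_{\gamma\in\Gamma}\chi(\gamma)e^{-\frac{\nu}{2}|\gamma|^2}H^{\nu}_{m,n}(\gamma;\overline{\gamma}).$$ Moreover, with $e_m(z)=z^m$, for all $z,w\in\mathbb{C}$, $$K^{\nu}_{\Gamma,\chi}(z,w)=\frac{\nu}{\pi}\sum_{m=0}^{\infty}\big[\mathcal{P}^{\nu}_{\Gamma,\chi}(e_m)\big](z)\,\frac{(\nu\overline{w})^m}{m!}.$$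
   Context: Pseudo-character: a map $\chi:\Gamma\to\{|\zeta|=1\}\subset\mathbb{C}$ with $\chi(\gamma+\gamma')=\chi(\gamma)\chi(\gamma')e^{\frac{\nu}{2}(\gamma\overline{\gamma'}-\overline{\gamma}\gamma')}$ for all $\gamma,\gamma'\in\Gamma$. Kernel function: $$K^{\nu}_{\Gamma,\chi}(z,w)=\frac{\nu}{\pi}\sum_{\gamma\in\Gamma}\chi(\gamma)e^{-\frac{\nu}{2}|\gamma|^2+\nu(z\overline{\gamma}-\overline{w}\gamma+z\overline{w})},$$ converging absolutely and uniformly on compact subsets of $\mathbb{C}\times\mathbb{C}$. Complex Hermite polynomials: $H^{\nu}_{m,n}(z,\overline{z})=(-1)^{m+n}e^{\nu|z|^2}\dfrac{\partial^{m+n}}{\partial\overline{z}^m\partial z^n}\big(e^{-\nu|z|^2}\big)$ for integers $m,n\ge 0$ ($\partial/\partial z$, $\partial/\partial\overline{z}$ being the Wirtinger derivatives). Poincaré theta operator: $\mathcal{P}^{\nu}_{\Gamma,\chi}(\psi)(z)=\sum_{\gamma\in\Gamma}\chi(\gamma)e^{-\frac{\nu}{2}|\gamma|^2+\nu z\overline{\gamma}}\psi(z-\gamma)$, provided the series converges. *)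

(* Defs.v *)
From Stdlib Require Import Reals ZArith List Classical Lra.
From Coquelicot Require Import Coquelicot.

Open Scope R_scope.

(* The directed set of finite subsets of [S], ordered by inclusion, as a filter.
   A finite subset is represented by a duplicate-free list of its elements. *)
Definition finite_subsets {I : Type} (S : I -> Prop) : (list I -> Prop) -> Prop :=
  fun P => exists F0 : list I, List.Forall S F0 /\
    forall F : list I, NoDup F -> List.Forall S F -> incl F0 F -> P F.

Definition Csum {I : Type} (f : I -> C) (F : list I) : C :=
  fold_right (fun i s => Cplus (f i) s) (RtoC 0) F.

(* Convergence along the net of finite partial sums; in [C] this is the same as
   absolute convergence. *)
Definition is_usum {I : Type} (S : I -> Prop) (f : I -> C) (l : C) : Prop :=
  filterlim (T := list I) (U := C_R_NormedModule) (Csum f) (finite_subsets S) (locally l).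

Definition ex_usum {I : Type} (S : I -> Prop) (f : I -> C) : Prop :=
  exists l : C, is_usum S f l.

(* The sum when [ex_usum S f] holds, unspecified otherwise. *)
Definition usum {I : Type} (S : I -> Prop) (f : I -> C) : C :=
  iota (T := C_R_CompleteNormedModule) (fun l => is_usum S f l).

Lemma NoDup_same_elements {I : Type} (F : list I) :
  exists F' : list I, NoDup F' /\ incl F F' /\ incl F' F.
Proof.
  induction F as [|a F [F' [HN [H1 H2]]]].
  - exists nil; repeat split; [constructor | intros x Hx; exact Hx | intros x Hx; exact Hx].
  - destruct (classic (In a F')) as [Ha|Ha].
    + exists F'; repeat split; auto.
      * intros x [<-|Hx]; auto.
      * intros x Hx; right; auto.
    + exists (a :: F'); repeat split.
      * constructor; assumption.
      * intros x [<-|Hx]; [left; reflexivity | right; auto].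
      * intros x [<-|Hx]; [left; reflexivity | right; auto].
Qed.

Global Instance finite_subsets_filter {I : Type} (S : I -> Prop) :
  ProperFilter (finite_subsets S).
Proof.
  constructor.
  - intros P [F0 [H0 HP]].
    destruct (NoDup_same_elements F0) as [F [HN [H1 H2]]].
    exists F; apply HP; auto.
    rewrite List.Forall_forall in H0 |- *; auto.
  - constructor.
    + exists nil; split; [constructor | auto].
    + intros P Q [F0 [H0 HP]] [F1 [H1 HQ]].
      exists (F0 ++ F1); split; [apply List.Forall_app; auto|].
      intros F HN HS Hi; split.
      * apply HP; auto. intros x Hx; apply Hi, in_or_app; auto.
      * apply HQ; auto. intros x Hx; apply Hi, in_or_app; auto.
    + intros P Q HPQ [F0 [H0 HP]]; exists F0; split; auto.
Qed.

Lemma is_usum_unique {I : Type} (S : I -> Prop) (f : I -> C) (l : C) :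
  is_usum S f l -> usum S f = l.
Proof.
  intros H.
  exact (iota_filterlim_locally (V := C_R_CompleteNormedModule) (Csum f) l H).
Qed.

Definition ex_Cseries (a : nat -> C) : Prop :=
  ex_series (V := C_R_NormedModule) a.

Definition Cseries (a : nat -> C) : C :=
  iota (T := C_R_CompleteNormedModule)
    (fun l => is_series (V := C_R_NormedModule) a l).

Definition Cexp (z : C) : C :=
  (exp (Re z) * cos (Im z), exp (Re z) * sin (Im z)).

Definition dx (f : C -> C) (z : C) : C :=
  (Derive (fun t : R => Re (f (t, Im z))) (Re z),
   Derive (fun t : R => Im (f (t, Im z))) (Re z)).

Definition dy (f : C -> C) (z : C) : C :=
  (Derive (fun t : R => Re (f (Re z, t))) (Im z),
   Derive (fun t : R => Im (f (Re z, t))) (Im z)).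

Definition d_z (f : C -> C) (z : C) : C :=
  (RtoC (/ 2) * (dx f z - Ci * dy f z))%C.

Definition d_zbar (f : C -> C) (z : C) : C :=
  (RtoC (/ 2) * (dx f z + Ci * dy f z))%C.

(* [hermite nu m n z] is H^nu_{m,n}(z, conj z). *)
Definition hermite (nu : R) (m n : nat) (z : C) : C :=
  (RtoC (-1) ^ (m + n) * RtoC (exp (nu * Cmod z ^ 2)) *
   Nat.iter m d_zbar
     (Nat.iter n d_z (fun u : C => RtoC (exp (- nu * Cmod u ^ 2)))) z)%C.

Definition R_independent (omega1 omega2 : C) : Prop :=
  forall a b : R, (RtoC a * omega1 + RtoC b * omega2)%C = RtoC 0 -> a = 0 /\ b = 0.

Definition lattice (omega1 omega2 : C) : C -> Prop :=
  fun gamma => exists p q : Z,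
    gamma = (RtoC (IZR p) * omega1 + RtoC (IZR q) * omega2)%C.

(* [chi] is total on [C], but only its values on [Gamma] are ever used. *)
Definition pseudo_character (Gamma : C -> Prop) (nu : R) (chi : C -> C) : Prop :=
  (forall g : C, Gamma g -> Cmod (chi g) = 1) /\
  (forall g g' : C, Gamma g -> Gamma g' ->
     chi (g + g')%C =
     (chi g * chi g' * Cexp (RtoC (nu / 2) * (g * Cconj g' - Cconj g * g')))%C).

Definition kernel_term (nu : R) (chi : C -> C) (z w g : C) : C :=
  (chi g * Cexp (RtoC (- (nu / 2) * Cmod g ^ 2) +
                 RtoC nu * (z * Cconj g - Cconj w * g + z * Cconj w)))%C.

Definition kernel (Gamma : C -> Prop) (nu : R) (chi : C -> C) (z w : C) : C :=
  (RtoC (nu / PI) * usum Gamma (kernel_term nu chi z w))%C.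

Definition coeff_term (nu : R) (chi : C -> C) (m n : nat) (g : C) : C :=
  (chi g * RtoC (exp (- (nu / 2) * Cmod g ^ 2)) * hermite nu m n g)%C.

Definition coeff (Gamma : C -> Prop) (nu : R) (chi : C -> C) (m n : nat) : C :=
  usum Gamma (coeff_term nu chi m n).

Definition theta_term (nu : R) (chi : C -> C) (psi : C -> C) (z g : C) : C :=
  (chi g * Cexp (RtoC (- (nu / 2) * Cmod g ^ 2) + RtoC nu * (z * Cconj g)) *
   psi (z - g))%C.

Definition theta_op (Gamma : C -> Prop) (nu : R) (chi : C -> C) (psi : C -> C)
    (z : C) : C :=
  usum Gamma (theta_term nu chi psi z).

Definition monomial (m : nat) (z : C) : C := (z ^ m)%C.

Definition expansion_term (Gamma : C -> Prop) (nu : R) (chi : C -> C) (z w : C)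
    (mn : nat * nat) : C :=
  (RtoC (-1) ^ fst mn * coeff Gamma nu chi (fst mn) (snd mn) *
   ((z ^ snd mn * Cconj w ^ fst mn) /
    RtoC (INR (fact (fst mn)) * INR (fact (snd mn)))))%C.

Definition theta_expansion_term (Gamma : C -> Prop) (nu : R) (chi : C -> C)
    (z w : C) (m : nat) : C :=
  (theta_op Gamma nu chi (monomial m) z *
   ((RtoC nu * Cconj w) ^ m / RtoC (INR (fact m))))%C.

(* Main.v *)
(* With [H_{m,n}] for the complex Hermite polynomials, induction on [m] in
   [H_{m+1,n} = nu z H_{m,n} - nu n H_{m,n-1}] gives
     [sum_n H_{m,n}(z) a^n / n! = (nu z - nu a)^m exp (nu a conj z)],
   and summing this against [b^m / m!] gives
     [sum_{m,n} H_{m,n}(z) a^n b^m / (m! n!) = exp (nu (a conj z + b z - a b))].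
   The same induction bounds the sums of the moduli by [exp (A |z| + B)].  For
   [z = gamma], [a = z], [b = - conj w] the double sum is the exponential factor
   of the kernel; against the Gaussian weight [exp (- nu/2 |gamma|^2)] the bounds
   are summable over the lattice, so the sums over [gamma] and over [(m, n)] may
   be exchanged.  The second expansion is the exchange with the Taylor series of
   [exp (nu conj w (z - gamma))]. *)

Require Import Defs.
From Stdlib Require Import Reals ZArith Lra Lia List Permutation Factorial.
From Stdlib Require Import Classical FunctionalExtensionality.
From Coquelicot Require Import Coquelicot.

Open Scope R_scope.

(** * Exponential and Wirtinger calculus *)

(** The sums in the statement are values of [usum] or [Cseries], unspecified on divergent families,
    so every value has to come with a proof of convergence. All of these are drawn from one finitary
    condition, [sum_bounded]. It can be checked row by row on a product, it restricts to columns,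
    and it forces convergence along finite subsets; the sum over the product then identifies the two
    iterated sums. Explicit bounds are therefore carried next to the values. Their exponent must
    stay affine in |gamma|: the weight exp (- nu/2 |gamma|^2) absorbs exp (A |gamma|) for every A,
    but not an arbitrary quadratic exponent. The Rodrigues formula enters only through the
    recursion. In it [d_zbar] is applied after all the [d_z], so only the [d_zbar] derivative of a
    general H_{m,n} has to be identified. [Cexp] is given by its real and imaginary parts, so its
    Taylor series is derived as well, from real mean value estimates. *)

Definition is_Cderive (f : R -> C) (t : R) (l : C) : Prop :=
  is_derive (fun s : R => Re (f s)) t (Re l) /\
  is_derive (fun s : R => Im (f s)) t (Im l).

Lemma is_Cderive_const (c : C) (t : R) : is_Cderive (fun _ => c) t (RtoC 0).
Proof. split; exact (is_derive_const _ t). Qed.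

Lemma is_Cderive_plus (f g : R -> C) (t : R) (a b : C) :
  is_Cderive f t a -> is_Cderive g t b ->
  is_Cderive (fun s => f s + g s)%C t (a + b)%C.
Proof.
  intros [H1 H2] [H3 H4]; split.
  - exact (is_derive_plus _ _ _ _ _ H1 H3).
  - exact (is_derive_plus _ _ _ _ _ H2 H4).
Qed.

Lemma is_Cderive_mult (f g : R -> C) (t : R) (a b : C) :
  is_Cderive f t a -> is_Cderive g t b ->
  is_Cderive (fun s => f s * g s)%C t (a * g t + f t * b)%C.
Proof.
  intros [H1 H2] [H3 H4]; split.
  - evar_last.
    + exact (is_derive_minus _ _ _ _ _
        (is_derive_mult _ _ _ _ _ H1 H3 Rmult_comm)
        (is_derive_mult _ _ _ _ _ H2 H4 Rmult_comm)).
    + unfold minus, plus, opp, mult; simpl; unfold Re, Im; simpl; ring.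
  - evar_last.
    + exact (is_derive_plus _ _ _ _ _
        (is_derive_mult _ _ _ _ _ H1 H4 Rmult_comm)
        (is_derive_mult _ _ _ _ _ H2 H3 Rmult_comm)).
    + unfold minus, plus, opp, mult; simpl; unfold Re, Im; simpl; ring.
Qed.

Lemma is_Cderive_exp (f : R -> C) (t : R) (a : C) :
  is_Cderive f t a -> is_Cderive (fun s => Cexp (f s)) t (a * Cexp (f t))%C.
Proof.
  intros [H1 H2].
  assert (He := is_derive_comp _ _ _ _ _ (is_derive_exp (Re (f t))) H1).
  assert (Hc := is_derive_comp _ _ _ _ _ (is_derive_cos (Im (f t))) H2).
  assert (Hs := is_derive_comp _ _ _ _ _ (is_derive_sin (Im (f t))) H2).
  split.
  - evar_last.
    + exact (is_derive_mult _ _ _ _ _ He Hc Rmult_comm).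
    + unfold plus, mult, scal; simpl; unfold mult; simpl; unfold Re, Im; ring.
  - evar_last.
    + exact (is_derive_mult _ _ _ _ _ He Hs Rmult_comm).
    + unfold plus, mult, scal; simpl; unfold mult; simpl; unfold Re, Im; ring.
Qed.

Lemma is_Cderive_eq (f : R -> C) (t : R) (a b : C) :
  is_Cderive f t a -> a = b -> is_Cderive f t b.
Proof. intros H <-; exact H. Qed.

Lemma is_Cderive_scal (c : C) (t : R) : is_Cderive (fun s => RtoC s * c)%C t c.
Proof.
  assert (H := is_Cderive_mult RtoC (fun _ => c) t (RtoC 1) (RtoC 0)
    (conj (is_derive_id t) (is_derive_const _ t)) (is_Cderive_const c t)).
  cbv beta in H; replace (RtoC 1 * c + t * 0)%C with c in H by ring; exact H.
Qed.

Lemma Cmod_le_Re_Im (z : C) : Cmod z <= Rabs (Re z) + Rabs (Im z).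
Proof.
  destruct z as [x y]; simpl.
  replace (x, y) with (RtoC x + Ci * RtoC y)%C
    by (apply injective_projections; simpl; ring).
  eapply Rle_trans; [apply Cmod_triangle|].
  rewrite Cmod_mult, Cmod_Ci, !Cmod_R; lra.
Qed.

Lemma Im_le_Cmod (z : C) : Rabs (Im z) <= Cmod z.
Proof.
  eapply Rle_trans; [|apply Rmax_Cmod]; apply Rmax_r.
Qed.

(** The mean value theorem is applied to the real and imaginary parts separately, with unrelated
    intermediate points; this costs the factor 2. *)
Lemma Cmean_value_le (f df : R -> C) (B : R) :
  (forall t, is_Cderive f t (df t)) ->
  (forall t, 0 <= t <= 1 -> Cmod (df t) <= B) ->
  Cmod (f 1 - f 0) <= 2 * B.
Proof.
  intros Hd HB.
  destruct (MVT_cor2 (fun s => Re (f s)) (fun s => Re (df s)) 0 1) as [c [Hc Ic]];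
    [lra | intros; apply is_derive_Reals, Hd |].
  destruct (MVT_cor2 (fun s => Im (f s)) (fun s => Im (df s)) 0 1) as [d [Hd' Id]];
    [lra | intros; apply is_derive_Reals, Hd |].
  eapply Rle_trans; [apply Cmod_le_Re_Im|].
  replace (Re (f 1 - f 0)) with (Re (df c)) by (simpl in *; unfold Re in *; lra).
  replace (Im (f 1 - f 0)) with (Im (df d)) by (simpl in *; unfold Im in *; lra).
  assert (H1 := re_le_Cmod (df c)); assert (H2 := Im_le_Cmod (df d)).
  assert (H3 := HB c ltac:(lra)); assert (H4 := HB d ltac:(lra)); lra.
Qed.

Lemma Cexp_plus (z w : C) : Cexp (z + w) = (Cexp z * Cexp w)%C.
Proof.
  unfold Cexp; apply injective_projections; simpl; rewrite exp_plus;
    [rewrite cos_plus | rewrite sin_plus]; unfold Re, Im; ring.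
Qed.

Lemma Cexp_RtoC (x : R) : Cexp (RtoC x) = RtoC (exp x).
Proof.
  unfold Cexp; apply injective_projections; simpl; rewrite ?cos_0, ?sin_0; ring.
Qed.

Lemma Cmod_Cexp (z : C) : Cmod (Cexp z) = exp (Re z).
Proof.
  replace (Cexp z) with (RtoC (exp (Re z)) * (cos (Im z), sin (Im z)))%C
    by (unfold Cexp; apply injective_projections; simpl; ring).
  rewrite Cmod_mult, Cmod_R, (Rabs_right (exp _)) by (left; apply exp_pos).
  replace (Cmod (cos (Im z), sin (Im z))) with 1; [ring|].
  unfold Cmod; transitivity (sqrt 1); [symmetry; exact sqrt_1 | f_equal].
  simpl; rewrite !Rmult_1_r, Rplus_comm; symmetry; exact (sin2_cos2 (Im z)).
Qed.

Lemma exp_le (x y : R) : x <= y -> exp x <= exp y.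
Proof.
  intros [H|H]; [left; apply exp_increasing, H | rewrite H; lra].
Qed.

Lemma Cinv_neq_0 (c : C) : c <> RtoC 0 -> (/ c)%C <> RtoC 0.
Proof.
  intros Hc E; apply C1_nz; rewrite <- (Cinv_r c Hc), E; ring.
Qed.

Lemma Cmod_Cexp_le (z : C) : Cmod (Cexp z) <= exp (Cmod z).
Proof.
  rewrite Cmod_Cexp.
  assert (H := re_le_Cmod z); apply Rabs_le_between in H.
  apply exp_le; lra.
Qed.

(* With [p = d_z F] and [q = d_zbar F], the partial derivatives are
   [p + q] in [x] and [i (p - q)] in [y]. *)
Definition is_wirtinger (F : C -> C) (z p q : C) : Prop :=
  is_Cderive (fun t => F (t, Im z)) (Re z) (p + q)%C /\
  is_Cderive (fun t => F (Re z, t)) (Im z) (Ci * (p - q))%C.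

(** [Derive] is total, so [d_z] has meaning only under differentiability, which the relation
    supplies; then ((p + q) - i · i (p - q)) / 2 = p. *)
Lemma is_wirtinger_d_z (F : C -> C) (z p q : C) :
  is_wirtinger F z p q -> d_z F z = p.
Proof.
  intros [[H1 H2] [H3 H4]]; cbv beta in *; unfold d_z, dx, dy.
  rewrite (is_derive_unique _ _ _ H1), (is_derive_unique _ _ _ H2),
    (is_derive_unique _ _ _ H3), (is_derive_unique _ _ _ H4).
  apply injective_projections; simpl; unfold Re, Im; simpl; field.
Qed.

Lemma is_wirtinger_d_zbar (F : C -> C) (z p q : C) :
  is_wirtinger F z p q -> d_zbar F z = q.
Proof.
  intros [[H1 H2] [H3 H4]]; cbv beta in *; unfold d_zbar, dx, dy.
  rewrite (is_derive_unique _ _ _ H1), (is_derive_unique _ _ _ H2),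
    (is_derive_unique _ _ _ H3), (is_derive_unique _ _ _ H4).
  apply injective_projections; simpl; unfold Re, Im; simpl; field.
Qed.

Lemma is_wirtinger_const (c z : C) :
  is_wirtinger (fun _ => c) z (RtoC 0) (RtoC 0).
Proof.
  split.
  - replace (RtoC 0 + RtoC 0)%C with (RtoC 0) by ring; apply is_Cderive_const.
  - replace (Ci * _)%C with (RtoC 0) by ring; apply is_Cderive_const.
Qed.

Lemma is_wirtinger_id (z : C) : is_wirtinger (fun u => u) z (RtoC 1) (RtoC 0).
Proof.
  split; split; simpl; (evar_last;
    [first [exact (is_derive_id _) | exact (is_derive_const _ _)]
    | unfold one, zero; simpl; ring]).
Qed.

Lemma is_wirtinger_conj (z : C) : is_wirtinger Cconj z (RtoC 0) (RtoC 1).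
Proof.
  split; split; simpl; (evar_last;
    [first [exact (is_derive_id _) | exact (is_derive_const _ _)
      | exact (is_derive_opp _ _ _ (is_derive_id _))
      | exact (is_derive_opp _ _ _ (is_derive_const _ _))]
    | unfold opp, one, zero; simpl; ring]).
Qed.

Lemma is_wirtinger_plus (F G : C -> C) (z p q p' q' : C) :
  is_wirtinger F z p q -> is_wirtinger G z p' q' ->
  is_wirtinger (fun u => F u + G u)%C z (p + p')%C (q + q')%C.
Proof.
  intros [H1 H2] [H3 H4]; split.
  - replace (p + p' + (q + q'))%C with ((p + q) + (p' + q'))%C by ring.
    exact (is_Cderive_plus _ _ _ _ _ H1 H3).
  - replace (Ci * _)%C with (Ci * (p - q) + Ci * (p' - q'))%C by ring.
    exact (is_Cderive_plus _ _ _ _ _ H2 H4).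
Qed.

Lemma is_wirtinger_mult (F G : C -> C) (z p q p' q' : C) :
  is_wirtinger F z p q -> is_wirtinger G z p' q' ->
  is_wirtinger (fun u => F u * G u)%C z
    (p * G z + F z * p')%C (q * G z + F z * q')%C.
Proof.
  (* With z an explicit pair, [F (Re z, Im z)] computes to [F z]. *)
  intros [H1 H2] [H3 H4]; destruct z as [x y]; split.
  - replace (_ + (q * _ + _))%C
      with ((p + q) * G (x, y) + F (x, y) * (p' + q'))%C by ring.
    exact (is_Cderive_mult _ _ _ _ _ H1 H3).
  - replace (Ci * (_ - (q * _ + _)))%C
      with (Ci * (p - q) * G (x, y) + F (x, y) * (Ci * (p' - q')))%C by ring.
    exact (is_Cderive_mult _ _ _ _ _ H2 H4).
Qed.

Lemma is_wirtinger_exp (F : C -> C) (z p q : C) :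
  is_wirtinger F z p q ->
  is_wirtinger (fun u => Cexp (F u)) z (p * Cexp (F z))%C (q * Cexp (F z))%C.
Proof.
  intros [H1 H2]; destruct z as [x y]; split.
  - replace (_ + q * _)%C with ((p + q) * Cexp (F (x, y)))%C by ring.
    exact (is_Cderive_exp _ _ _ H1).
  - replace (Ci * (_ - q * _))%C
      with (Ci * (p - q) * Cexp (F (x, y)))%C by ring.
    exact (is_Cderive_exp _ _ _ H2).
Qed.

(** At [n = 0] the exponent [pred 0 = 0] is spurious, but the factor [INR 0] cancels it. *)
Lemma is_wirtinger_pow (F : C -> C) (z p q : C) (n : nat) :
  is_wirtinger F z p q ->
  is_wirtinger (fun u => F u ^ n)%C z
    (RtoC (INR n) * F z ^ pred n * p)%C (RtoC (INR n) * F z ^ pred n * q)%C.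
Proof.
  intros H; induction n as [|n IH].
  - replace (_ * p)%C with (RtoC 0) by (simpl; ring).
    replace (_ * q)%C with (RtoC 0) by (simpl; ring).
    apply (is_wirtinger_const (RtoC 1)).
  - assert (E := is_wirtinger_mult _ _ _ _ _ _ _ H IH).
    assert (D : forall r : C, (RtoC (INR (S n)) * F z ^ pred (S n) * r =
        r * F z ^ n + F z * (RtoC (INR n) * F z ^ pred n * r))%C).
    { intros r; rewrite S_INR, RtoC_plus; destruct n; simpl; ring. }
    rewrite !D; exact E.
Qed.

(* [H^nu_{m,n}(z, conj z)], through the recursion
   [H_{m+1,n} = nu z H_{m,n} - d_zbar H_{m,n}] and
   [d_zbar H_{m,n} = nu n H_{m,n-1}]. *)
Fixpoint hpoly (nu : R) (m n : nat) (z : C) : C :=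
  match m with
  | O => ((RtoC nu * Cconj z) ^ n)%C
  | S m' => (RtoC nu * z * hpoly nu m' n z
             - RtoC nu * RtoC (INR n) * hpoly nu m' (pred n) z)%C
  end.

(** Since z has zero [d_zbar] derivative, differentiating the recursion reproduces it with n lowered
    by one. The [d_z] part is left existential: it only witnesses differentiability. *)
Lemma is_wirtinger_hpoly (nu : R) (m n : nat) (z : C) :
  exists p, is_wirtinger (hpoly nu m n) z p
    (RtoC nu * RtoC (INR n) * hpoly nu m (pred n) z)%C.
Proof.
  revert n; induction m as [|m IH]; intros n; simpl hpoly.
  - eexists.
    replace (RtoC nu * _ * _)%C
      with (RtoC (INR n) * (RtoC nu * Cconj z) ^ pred n *
            (RtoC 0 * Cconj z + RtoC nu * RtoC 1))%C by ring.
    apply (is_wirtinger_pow (fun u => RtoC nu * Cconj u)%C).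
    apply is_wirtinger_mult; [apply is_wirtinger_const | apply is_wirtinger_conj].
  - destruct (IH n) as [p Hp]; destruct (IH (pred n)) as [p' Hp'].
    assert (H1 := is_wirtinger_mult _ _ _ _ _ _ _
      (is_wirtinger_mult _ _ _ _ _ _ _
        (is_wirtinger_const (RtoC nu) z) (is_wirtinger_id z)) Hp).
    assert (H2 := is_wirtinger_mult _ _ _ _ _ _ _
      (is_wirtinger_const (- (RtoC nu * RtoC (INR n)))%C z) Hp').
    assert (H := is_wirtinger_plus _ _ _ _ _ _ _ H1 H2); cbv beta in H.
    eexists. eapply eq_ind; [eapply (eq_ind _ (fun F => is_wirtinger F _ _ _)); [exact H|]|].
    + apply functional_extensionality; intros u; ring.
    + ring.
Qed.

Definition gaussian (nu : R) (u : C) : C := RtoC (exp (- nu * Cmod u ^ 2)).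

Lemma is_wirtinger_gaussian (nu : R) (z : C) :
  is_wirtinger (gaussian nu) z
    (- RtoC nu * Cconj z * gaussian nu z)%C (- RtoC nu * z * gaussian nu z)%C.
Proof.
  assert (E : gaussian nu = fun u => Cexp (RtoC (- nu) * (u * Cconj u))%C).
  { apply functional_extensionality; intros u; unfold gaussian.
    rewrite <- Cexp_RtoC, RtoC_mult, Cmod2_conj; reflexivity. }
  rewrite E.
  assert (H := is_wirtinger_exp _ _ _ _ (is_wirtinger_mult _ _ _ _ _ _ _
    (is_wirtinger_const (RtoC (- nu)) z)
    (is_wirtinger_mult _ _ _ _ _ _ _ (is_wirtinger_id z) (is_wirtinger_conj z)))).
  cbv beta in H; revert H; rewrite RtoC_opp; intros H.
  replace (- RtoC nu * Cconj z)%C with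
    (0 * (z * Cconj z) + - nu * (1 * Cconj z + z * 0))%C by ring.
  replace (- RtoC nu * z)%C with
    (0 * (z * Cconj z) + - nu * (0 * Cconj z + z * 1))%C by ring.
  exact H.
Qed.

(** The polynomial factor depends on conj z alone, so each [d_z] acts on the Gaussian only and
    contributes - nu conj z. *)
Lemma iter_d_z_gaussian (nu : R) (n : nat) :
  Nat.iter n d_z (gaussian nu) =
  fun z => (RtoC (-1) ^ n * hpoly nu 0 n z * gaussian nu z)%C.
Proof.
  induction n as [|n IH]; apply functional_extensionality; intros z.
  - simpl; ring.
  - simpl Nat.iter; rewrite IH; simpl hpoly.
    rewrite (is_wirtinger_d_z _ _ _ _ (is_wirtinger_mult _ _ _ _ _ _ _
      (is_wirtinger_mult _ _ _ _ _ _ _ (is_wirtinger_const _ z)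
        (is_wirtinger_pow _ _ _ _ n (is_wirtinger_mult _ _ _ _ _ _ _
           (is_wirtinger_const _ z) (is_wirtinger_conj z))))
      (is_wirtinger_gaussian nu z))).
    simpl Cpow; replace (RtoC (-1)) with (- RtoC 1)%C by (rewrite <- RtoC_opp; reflexivity); ring.
Qed.

(** One [d_zbar] turns H_{m,n} times the Gaussian into (nu n H_{m,n-1} - nu z H_{m,n}) times the
    Gaussian, which is minus the recursion for H_{m+1,n}. *)
Lemma iter_d_zbar_gaussian (nu : R) (m n : nat) :
  Nat.iter m d_zbar (Nat.iter n d_z (gaussian nu)) =
  fun z => (RtoC (-1) ^ (m + n) * hpoly nu m n z * gaussian nu z)%C.
Proof.
  induction m as [|m IH]; [apply iter_d_z_gaussian|].
  apply functional_extensionality; intros z; simpl Nat.iter; rewrite IH.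
  destruct (is_wirtinger_hpoly nu m n z) as [p Hp].
  rewrite (is_wirtinger_d_zbar _ _ _ _ (is_wirtinger_mult _ _ _ _ _ _ _
    (is_wirtinger_mult _ _ _ _ _ _ _ (is_wirtinger_const _ z) Hp)
    (is_wirtinger_gaussian nu z))).
  simpl; replace (RtoC (-1)) with (- RtoC 1)%C by (rewrite <- RtoC_opp; reflexivity); ring.
Qed.

Lemma hermite_hpoly (nu : R) (m n : nat) (z : C) :
  hermite nu m n z = hpoly nu m n z.
Proof.
  unfold hermite; fold (gaussian nu); rewrite iter_d_zbar_gaussian.
  unfold gaussian.
  transitivity ((RtoC (-1) * RtoC (-1)) ^ (m + n) *
    (RtoC (exp (nu * Cmod z ^ 2)) * RtoC (exp (- nu * Cmod z ^ 2))) *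
    hpoly nu m n z)%C; [rewrite Cpow_mult_l; ring|].
  rewrite <- !RtoC_mult, <- exp_plus.
  replace (nu * _ + _) with 0 by ring; rewrite exp_0.
  replace (-1 * -1) with 1 by ring; rewrite Cpow_1_l; ring.
Qed.

(** * Unordered sums *)

Definition Rsum {I : Type} (u : I -> R) (F : list I) : R :=
  fold_right (fun i s => u i + s) 0 F.

(** For nonnegative u this is summability without a limit; bounds of this kind compose by comparison
    of finite sums. *)
Definition sum_bounded {I : Type} (S : I -> Prop) (u : I -> R) (M : R) : Prop :=
  forall F : list I, NoDup F -> List.Forall S F -> Rsum u F <= M.

Definition set_prod {I J : Type} (S : I -> Prop) (T : J -> Prop) (p : I * J) : Prop :=
  S (fst p) /\ T (snd p).

Lemma Csum_app {I : Type} (f : I -> C) (F G : list I) :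
  Csum f (F ++ G) = (Csum f F + Csum f G)%C.
Proof.
  induction F as [|a F IH]; simpl; [ring | rewrite IH; ring].
Qed.

Lemma Csum_Permutation {I : Type} (f : I -> C) (F G : list I) :
  Permutation F G -> Csum f F = Csum f G.
Proof.
  induction 1; simpl; [reflexivity | congruence | ring | congruence].
Qed.

Lemma Csum_map {I J : Type} (h : I -> J) (f : J -> C) (F : list I) :
  Csum f (map h F) = Csum (fun i => f (h i)) F.
Proof. induction F; simpl; congruence. Qed.

Lemma Csum_mult_l {I : Type} (c : C) (f : I -> C) (F : list I) :
  Csum (fun i => c * f i)%C F = (c * Csum f F)%C.
Proof. induction F as [|a F IH]; simpl; [ring | rewrite IH; ring]. Qed.

Lemma Csum_plus {I : Type} (f g : I -> C) (F : list I) :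
  Csum (fun i => f i + g i)%C F = (Csum f F + Csum g F)%C.
Proof. induction F as [|a F IH]; simpl; [ring | rewrite IH; ring]. Qed.

Lemma Csum_ext_Forall {I : Type} (S : I -> Prop) (f g : I -> C) (F : list I) :
  (forall i, S i -> f i = g i) -> List.Forall S F -> Csum f F = Csum g F.
Proof.
  intros H; induction 1 as [|a F Ha _ IH]; simpl; [reflexivity|].
  rewrite IH, H; auto.
Qed.

Lemma Csum_list_prod {I J : Type} (f : I * J -> C) (A : list I) (B : list J) :
  Csum f (list_prod A B) = Csum (fun i => Csum (fun j => f (i, j)) B) A.
Proof.
  induction A as [|a A IH]; simpl; [reflexivity|].
  rewrite Csum_app, IH, Csum_map; reflexivity.
Qed.

Lemma Rsum_app {I : Type} (u : I -> R) (F G : list I) :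
  Rsum u (F ++ G) = Rsum u F + Rsum u G.
Proof.
  induction F as [|a F IH]; simpl; [ring | rewrite IH; ring].
Qed.

Lemma Rsum_Permutation {I : Type} (u : I -> R) (F G : list I) :
  Permutation F G -> Rsum u F = Rsum u G.
Proof.
  induction 1; simpl; [reflexivity | congruence | ring | congruence].
Qed.

Lemma Rsum_map {I J : Type} (h : I -> J) (u : J -> R) (F : list I) :
  Rsum u (map h F) = Rsum (fun i => u (h i)) F.
Proof. induction F; simpl; congruence. Qed.

Lemma Rsum_mult_l {I : Type} (c : R) (u : I -> R) (F : list I) :
  Rsum (fun i => c * u i) F = c * Rsum u F.
Proof. induction F as [|a F IH]; simpl; [ring | rewrite IH; ring]. Qed.

Lemma Rsum_plus {I : Type} (u v : I -> R) (F : list I) :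
  Rsum (fun i => u i + v i) F = Rsum u F + Rsum v F.
Proof. induction F as [|a F IH]; simpl; [ring | rewrite IH; ring]. Qed.

Lemma Rsum_le {I : Type} (S : I -> Prop) (u v : I -> R) (F : list I) :
  (forall i, S i -> u i <= v i) -> List.Forall S F -> Rsum u F <= Rsum v F.
Proof.
  intros H; induction 1 as [|a F Ha _ IH]; simpl; [lra|].
  assert (H1 := H a Ha); lra.
Qed.

Lemma Rsum_nonneg {I : Type} (u : I -> R) (F : list I) :
  (forall i, 0 <= u i) -> 0 <= Rsum u F.
Proof.
  intros H; induction F as [|a F IH]; simpl; [lra|].
  assert (H1 := H a); lra.
Qed.

Lemma Rsum_list_prod {I J : Type} (u : I * J -> R) (A : list I) (B : list J) :
  Rsum u (list_prod A B) = Rsum (fun i => Rsum (fun j => u (i, j)) B) A.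
Proof.
  induction A as [|a A IH]; simpl; [reflexivity|].
  rewrite Rsum_app, IH, Rsum_map; reflexivity.
Qed.

Lemma Cmod_Csum_le {I : Type} (f : I -> C) (F : list I) :
  Cmod (Csum f F) <= Rsum (fun i => Cmod (f i)) F.
Proof.
  induction F as [|a F IH]; simpl; [rewrite Cmod_0; lra|].
  assert (H := Cmod_triangle (f a) (Csum f F)); lra.
Qed.

(** The list form of splitting G into F and its complement, used to isolate the tail of a finite
    sum. *)
Lemma incl_Permutation_app {I : Type} (F G : list I) :
  NoDup F -> incl F G -> exists G', Permutation G (F ++ G').
Proof.
  intros HN; revert G; induction HN as [|a F Ha HN IH]; intros G Hi.
  - exists G; apply Permutation_refl.
  - destruct (in_split a G) as [G1 [G2 ->]]; [apply Hi; left; reflexivity|].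
    destruct (IH (G1 ++ G2)) as [G' HG'].
    + intros x Hx.
      assert (Hx' := Hi x (or_intror Hx)); apply in_app_or in Hx'.
      apply in_or_app; destruct Hx' as [|[<-|]]; tauto.
    + exists G'; simpl.
      eapply Permutation_trans; [apply Permutation_sym, Permutation_middle|].
      apply perm_skip, HG'.
Qed.

Lemma Rsum_incl_le {I : Type} (u : I -> R) (F G : list I) :
  (forall i, 0 <= u i) -> NoDup F -> incl F G -> Rsum u F <= Rsum u G.
Proof.
  intros Hu HN Hi; destruct (incl_Permutation_app F G HN Hi) as [G' HG'].
  rewrite (Rsum_Permutation _ _ _ HG'), Rsum_app.
  assert (H := Rsum_nonneg u G' Hu); lra.
Qed.

Lemma NoDup_list_prod {I J : Type} (A : list I) (B : list J) :
  NoDup A -> NoDup B -> NoDup (list_prod A B).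
Proof.
  intros HA HB; induction HA as [|a A Ha HA IH]; simpl; [constructor|].
  apply NoDup_app; [| exact IH |].
  - apply FinFun.Injective_map_NoDup; [|exact HB].
    intros x y E; congruence.
  - intros [x y] H1 H2; apply in_map_iff in H1.
    destruct H1 as [y' [E _]]; apply in_prod_iff in H2.
    injection E as <- <-; tauto.
Qed.

Lemma Forall_list_prod {I J : Type} (S : I -> Prop) (T : J -> Prop)
    (A : list I) (B : list J) :
  List.Forall S A -> List.Forall T B -> List.Forall (set_prod S T) (list_prod A B).
Proof.
  rewrite !List.Forall_forall; intros HA HB [x y] H.
  apply in_prod_iff in H; split; [apply HA | apply HB]; tauto.
Qed.

(** Tonelli: a finite set of pairs lies in the rectangle of its projections, and by positivity
    enlarging to the rectangle only increases the sum. The projections are freed of duplicates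
    because the bounds speak only about duplicate-free lists. *)
Lemma sum_bounded_prod {I J : Type} (S : I -> Prop) (T : J -> Prop)
    (u : I * J -> R) (B : I -> R) (M : R) :
  (forall p, 0 <= u p) ->
  (forall i, S i -> sum_bounded T (fun j => u (i, j)) (B i)) ->
  sum_bounded S B M -> sum_bounded (set_prod S T) u M.
Proof.
  intros Hu HB HM F HN HF.
  destruct (NoDup_same_elements (map fst F)) as [X [NX [X1 X2]]].
  destruct (NoDup_same_elements (map snd F)) as [Y [NY [Y1 Y2]]].
  rewrite List.Forall_forall in HF.
  assert (HX : List.Forall S X).
  { apply List.Forall_forall; intros x Hx; apply X2, in_map_iff in Hx.
    destruct Hx as [p [<- Hp]]; apply HF, Hp. }
  assert (HY : List.Forall T Y).
  { apply List.Forall_forall; intros y Hy; apply Y2, in_map_iff in Hy.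
    destruct Hy as [p [<- Hp]]; apply HF, Hp. }
  apply Rle_trans with (Rsum u (list_prod X Y)).
  - apply Rsum_incl_le; [exact Hu | exact HN |].
    intros [x y] Hp; apply in_prod_iff; split;
      [apply X1, (in_map fst _ _ Hp) | apply Y1, (in_map snd _ _ Hp)].
  - rewrite Rsum_list_prod.
    apply Rle_trans with (Rsum B X); [|apply HM; assumption].
    apply (Rsum_le S); [|exact HX].
    intros i Hi; apply HB; assumption.
Qed.

Lemma sum_bounded_slice {I J : Type} (S : I -> Prop) (T : J -> Prop)
    (u : I * J -> R) (M : R) (j : J) :
  sum_bounded (set_prod S T) u M -> T j -> sum_bounded S (fun i => u (i, j)) M.
Proof.
  intros H Hj F HN HF; rewrite <- (Rsum_map (fun i => (i, j)) u F); apply H.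
  - apply FinFun.Injective_map_NoDup; [|exact HN].
    intros x y E; congruence.
  - apply List.Forall_forall; intros p Hp; apply in_map_iff in Hp.
    destruct Hp as [i [<- Hi]]; rewrite List.Forall_forall in HF.
    split; [apply HF, Hi | exact Hj].
Qed.

Lemma sum_bounded_le {I : Type} (S : I -> Prop) (u v : I -> R) (M : R) :
  (forall i, S i -> u i <= v i) -> sum_bounded S v M -> sum_bounded S u M.
Proof.
  intros H HM F HN HF; eapply Rle_trans; [|apply HM; eassumption].
  apply (Rsum_le S); assumption.
Qed.

Lemma sum_bounded_mult_l {I : Type} (S : I -> Prop) (c : R) (u : I -> R) (M : R) :
  0 <= c -> sum_bounded S u M -> sum_bounded S (fun i => c * u i) (c * M).
Proof.
  intros Hc HM F HN HF; rewrite Rsum_mult_l.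
  apply Rmult_le_compat_l; [exact Hc | apply HM; assumption].
Qed.

Lemma is_usum_Cmod {I : Type} (S : I -> Prop) (f : I -> C) (l : C) :
  is_usum S f l <->
  forall eps, 0 < eps -> finite_subsets S (fun F => Cmod (Csum f F - l) < eps).
Proof.
  unfold is_usum.
  rewrite (filterlim_locally_ball_norm (U := C_R_NormedModule)); split.
  - intros H eps He.
    apply filter_imp with (2 := H (mkposreal eps He)).
    intros F HF; rewrite Cmod_norm; exact HF.
  - intros H eps.
    apply filter_imp with (2 := H eps (cond_pos eps)).
    intros F HF; rewrite Cmod_norm in HF; exact HF.
Qed.

(** Cauchy criterion: let s be the supremum of the finite sums of moduli and [F0] a finite set whose
    sum exceeds s - e. Whatever a larger set adds to [F0] has total modulus below e. *)
Lemma ex_usum_bounded {I : Type} (S : I -> Prop) (f : I -> C) (M : R) :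
  sum_bounded S (fun i => Cmod (f i)) M -> ex_usum S f.
Proof.
  intros HM.
  set (u := fun i => Cmod (f i)) in HM.
  set (E := fun r => exists F, NoDup F /\ List.Forall S F /\ r = Rsum u F).
  destruct (completeness E) as [s [Hub Hlub]].
  - exists M; intros r [F [HN [HF ->]]]; apply HM; assumption.
  - exists 0, nil; repeat split; constructor.
  - apply (filterlim_locally_cauchy (U := C_R_CompleteNormedModule)).
    intros eps.
    assert (He := is_pos_div_2 eps); set (e := eps / 2) in He.
    assert (HF0 : exists F0, NoDup F0 /\ List.Forall S F0 /\ s - e < Rsum u F0).
    { apply NNPP; intros Hn.
      assert (Hs : s <= s - e); [|lra].
      apply Hlub; intros r [F [HN [HF ->]]]; apply Rnot_lt_le; intros Hlt.
      apply Hn; exists F; auto. }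
    destruct HF0 as [F0 [HN0 [HS0 Hs0]]].
    assert (Hclose : forall F, NoDup F -> List.Forall S F -> incl F0 F ->
        Cmod (Csum f F - Csum f F0) < e).
    { intros F HN HF Hi.
      destruct (incl_Permutation_app F0 F HN0 Hi) as [G HG].
      assert (HR : Rsum u F <= s) by (apply Hub; exists F; auto).
      rewrite (Rsum_Permutation _ _ _ HG), Rsum_app in HR.
      rewrite (Csum_Permutation _ _ _ HG), Csum_app.
      replace (Csum f F0 + Csum f G - Csum f F0)%C with (Csum f G) by ring.
      assert (H := Cmod_Csum_le f G); fold u in H; lra. }
    exists (fun F => Cmod (Csum f F - Csum f F0) < e); split.
    + exists F0; split; [exact HS0 | exact Hclose].
    + intros F G HF HG.
      apply (norm_compat1 (V := C_R_NormedModule)).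
      change (norm (V := C_R_NormedModule) (Csum f G - Csum f F)%C < eps).
      change (norm (V := prod_NormedModule R_AbsRing R_NormedModule R_NormedModule)
        (Csum f G - Csum f F)%C < eps).
      rewrite <- Cmod_norm.
      replace (Csum f G - Csum f F)%C
        with ((Csum f G - Csum f F0) + - (Csum f F - Csum f F0))%C by ring.
      eapply Rle_lt_trans; [apply Cmod_triangle|].
      rewrite Cmod_opp; unfold e in *; lra.
Qed.

Lemma is_usum_ext {I : Type} (S : I -> Prop) (f g : I -> C) (l : C) :
  (forall i, S i -> f i = g i) -> is_usum S f l -> is_usum S g l.
Proof.
  rewrite !is_usum_Cmod; intros E H eps He.
  destruct (H eps He) as [F0 [H0 HF]]; exists F0; split; [exact H0|].
  intros F HN HS Hi; rewrite <- (Csum_ext_Forall S f g F E HS); auto.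
Qed.

Lemma is_usum_set_ext {I : Type} (S S' : I -> Prop) (f : I -> C) (l : C) :
  (forall i, S i <-> S' i) -> is_usum S f l -> is_usum S' f l.
Proof.
  rewrite !is_usum_Cmod; intros E H eps He.
  destruct (H eps He) as [F0 [H0 HF]]; exists F0; split.
  - eapply List.Forall_impl; [|exact H0]; intros i; apply E.
  - intros F HN HS Hi; apply HF; auto.
    eapply List.Forall_impl; [|exact HS]; intros i; apply E.
Qed.

Lemma is_usum_mult_l {I : Type} (S : I -> Prop) (c : C) (f : I -> C) (l : C) :
  is_usum S f l -> is_usum S (fun i => c * f i)%C (c * l)%C.
Proof.
  rewrite !is_usum_Cmod; intros H eps He.
  assert (Hc : 0 < Cmod c + 1) by (assert (H1 := Cmod_ge_0 c); lra).
  eapply filter_imp; [|exact (H (eps / (Cmod c + 1)) (Rdiv_lt_0_compat _ _ He Hc))].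
  simpl; intros F HF; rewrite Csum_mult_l.
  replace (c * Csum f F - c * l)%C with (c * (Csum f F - l))%C by ring.
  rewrite Cmod_mult.
  assert (H1 := Cmod_ge_0 c); assert (H2 := Cmod_ge_0 (Csum f F - l)).
  apply Rle_lt_trans with ((Cmod c + 1) * Cmod (Csum f F - l)); [nra|].
  apply (Rmult_lt_compat_l (Cmod c + 1)) in HF; [|exact Hc].
  replace ((Cmod c + 1) * (eps / (Cmod c + 1))) with eps in HF by (field; lra).
  exact HF.
Qed.

Lemma ex_usum_mult_l_inv {I : Type} (S : I -> Prop) (c : C) (f : I -> C) :
  c <> RtoC 0 -> ex_usum S (fun i => c * f i)%C -> ex_usum S f.
Proof.
  intros Hc [l Hl]; exists (/ c * l)%C.
  refine (is_usum_ext _ _ _ _ _ (is_usum_mult_l _ (/ c)%C _ _ Hl)).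
  intros i _; field; exact Hc.
Qed.

Lemma usum_mult_l {I : Type} (S : I -> Prop) (c : C) (f : I -> C) :
  ex_usum S f -> usum S (fun i => c * f i)%C = (c * usum S f)%C.
Proof.
  intros [l Hl]; rewrite (is_usum_unique _ _ _ Hl).
  apply is_usum_unique, is_usum_mult_l, Hl.
Qed.

Lemma is_usum_swap {I J : Type} (S : I -> Prop) (T : J -> Prop)
    (f : I * J -> C) (L : C) :
  is_usum (set_prod S T) f L ->
  is_usum (set_prod T S) (fun p => f (snd p, fst p)) L.
Proof.
  rewrite !is_usum_Cmod; intros H eps He.
  destruct (H eps He) as [F0 [H0 HF]]; rewrite List.Forall_forall in H0.
  exists (map (fun p => (snd p, fst p)) F0); split.
  - apply List.Forall_forall; intros p Hp; apply in_map_iff in Hp.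
    destruct Hp as [q [<- Hq]]; destruct (H0 q Hq); split; assumption.
  - intros F HN HS Hi; rewrite <- (Csum_map (fun p => (snd p, fst p)) f); apply HF.
    + apply FinFun.Injective_map_NoDup; [|exact HN].
      intros [x y] [x' y'] E; simpl in E; congruence.
    + rewrite List.Forall_forall in *; intros p Hp; apply in_map_iff in Hp.
      destruct Hp as [q [<- Hq]]; destruct (HS q Hq); split; assumption.
    + intros [x y] Hp; apply in_map_iff; exists (y, x); split; [reflexivity|].
      apply Hi, (in_map (fun p => (snd p, fst p)) _ _ Hp).
Qed.

(** Finitely many rows can be approximated by one common finite set of columns, since a filter is
    closed under finite intersections. *)
Lemma Csum_limit {I J : Type} (S : I -> Prop) (T : J -> Prop)
    (f : I * J -> C) (l : I -> C) (A : list I) :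
  (forall i, S i -> is_usum T (fun j => f (i, j)) (l i)) -> List.Forall S A ->
  forall eps, 0 < eps -> finite_subsets T
    (fun B => Cmod (Csum (fun i => Csum (fun j => f (i, j)) B) A - Csum l A) < eps).
Proof.
  intros H; induction 1 as [|a A Ha _ IH]; intros eps He.
  - simpl; apply filter_forall; intros _.
    replace (RtoC 0 - RtoC 0)%C with (RtoC 0) by ring; rewrite Cmod_0; exact He.
  - assert (H1 := proj1 (is_usum_Cmod _ _ _) (H a Ha) (eps / 2) ltac:(lra)).
    assert (H2 := IH (eps / 2) ltac:(lra)).
    eapply filter_imp; [|exact (filter_and _ _ H1 H2)].
    simpl; intros B [HB1 HB2].
    match goal with |- Cmod ?x < _ => replace x with
      ((Csum (fun j => f (a, j)) B - l a) +
       (Csum (fun i => Csum (fun j => f (i, j)) B) A - Csum l A))%C by ring end.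
    eapply Rle_lt_trans; [apply Cmod_triangle | lra].
Qed.

(** For a finite A containing the first projections of [F0], a set B is chosen afterwards, depending
    on A: large enough to contain the second projections and to bring the row sums near their
    limits. The rectangle A x B then contains [F0], so its sum is close both to L and to the sum of
    l over A. *)
Lemma is_usum_Fubini {I J : Type} (S : I -> Prop) (T : J -> Prop)
    (f : I * J -> C) (l : I -> C) (L : C) :
  is_usum (set_prod S T) f L ->
  (forall i, S i -> is_usum T (fun j => f (i, j)) (l i)) -> is_usum S l L.
Proof.
  rewrite !is_usum_Cmod; intros HL Hl eps He.
  destruct (HL (eps / 2) ltac:(lra)) as [F0 [H0 HF]].
  rewrite List.Forall_forall in H0.
  exists (map fst F0); split.
  { apply List.Forall_forall; intros x Hx; apply in_map_iff in Hx.
    destruct Hx as [p [<- Hp]]; apply H0, Hp. }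
  intros A NA SA IA.
  assert (H1 := Csum_limit S T f l A Hl SA (eps / 2) ltac:(lra)).
  (* Admissibility of B is itself an event of the filter, so it can be intersected with [H1] and a
     single witness extracted. *)
  assert (H2 : finite_subsets T
    (fun B => NoDup B /\ List.Forall T B /\ incl (map snd F0) B)).
  { exists (map snd F0); split; [|auto].
    apply List.Forall_forall; intros x Hx; apply in_map_iff in Hx.
    destruct Hx as [p [<- Hp]]; apply H0, Hp. }
  destruct (filter_ex _ (filter_and _ _ H1 H2)) as [B [HB [NB [SB IB]]]].
  rewrite <- Csum_list_prod in HB.
  assert (HP : Cmod (Csum f (list_prod A B) - L) < eps / 2).
  { apply HF; [apply NoDup_list_prod | apply Forall_list_prod |]; auto.
    intros [x y] Hp; apply in_prod_iff; split;
      [apply IA, (in_map fst _ _ Hp) | apply IB, (in_map snd _ _ Hp)]. }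
  replace (Csum l A - L)%C with
    (- (Csum f (list_prod A B) - Csum l A) + (Csum f (list_prod A B) - L))%C by ring.
  eapply Rle_lt_trans; [apply Cmod_triangle | rewrite Cmod_opp; lra].
Qed.

(** Row sums are supplied in closed form; column sums exist by slicing the bound. Both iterated sums
    are compared with the sum over the product, the second after swapping the factors. *)
Lemma usum_exchange {I J : Type} (S : I -> Prop) (T : J -> Prop)
    (f : I * J -> C) (l : I -> C) (M : R) :
  sum_bounded (set_prod S T) (fun p => Cmod (f p)) M ->
  (forall i, S i -> is_usum T (fun j => f (i, j)) (l i)) ->
  exists L, is_usum (set_prod S T) f L /\ is_usum S l L /\
    (forall j, T j -> ex_usum S (fun i => f (i, j))) /\
    is_usum T (fun j => usum S (fun i => f (i, j))) L.
Proof.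
  intros HM Hl.
  assert (Hex : forall j, T j -> ex_usum S (fun i => f (i, j))).
  { intros j Hj; apply (ex_usum_bounded S _ M).
    exact (sum_bounded_slice S T (fun p => Cmod (f p)) M j HM Hj). }
  destruct (ex_usum_bounded _ _ _ HM) as [L HL]; exists L; repeat split; auto.
  - exact (is_usum_Fubini S T f l L HL Hl).
  - apply (is_usum_Fubini T S _ _ L (is_usum_swap S T f L HL)).
    intros j Hj; destruct (Hex j Hj) as [x Hx]; simpl.
    rewrite (is_usum_unique _ _ _ Hx); exact Hx.
Qed.

(** * Unordered sums over the natural numbers and ordered series *)

Definition all_nat (_ : nat) : Prop := True.

Lemma incl_seq (F : list nat) : exists N, forall n, (N <= n)%nat -> incl F (seq 0 n).
Proof.
  induction F as [|a F [N HN]].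
  - exists O; intros n _ x [].
  - exists (Nat.max (S a) N); intros n Hn x [<-|Hx].
    + apply in_seq; lia.
    + apply (HN n); [lia | exact Hx].
Qed.

(** Initial segments eventually contain any finite set, so unordered convergence implies convergence
    of ordered partial sums. *)
Lemma finite_subsets_seq (P : list nat -> Prop) :
  finite_subsets all_nat P -> eventually (fun n => P (seq 0 n)).
Proof.
  intros [F0 [_ HP]]; destruct (incl_seq F0) as [N HN]; exists N; intros n Hn.
  apply HP; [apply seq_NoDup | | apply HN, Hn].
  apply List.Forall_forall; intros; exact Logic.I.
Qed.

Lemma Csum_seq_S (f : nat -> C) (n : nat) :
  Csum f (seq 0 (S n)) = (Csum f (seq 0 n) + f n)%C.
Proof. rewrite seq_S, Csum_app; simpl; ring. Qed.

(** [sum_n f n] includes the index n, hence the segment of length [S n]. *)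
Lemma Csum_seq_sum_n (f : nat -> C) (n : nat) :
  Csum f (seq 0 (S n)) = sum_n (G := C_R_NormedModule) f n.
Proof.
  induction n as [|n IH].
  - rewrite sum_O; simpl; apply Cplus_0_r.
  - rewrite Csum_seq_S, IH, sum_Sn; reflexivity.
Qed.

Lemma is_usum_is_series (f : nat -> C) (l : C) :
  is_usum all_nat f l -> is_series (V := C_R_NormedModule) f l.
Proof.
  intros H P HP; apply H, finite_subsets_seq in HP; destruct HP as [N HN].
  exists N; intros n Hn; rewrite <- Csum_seq_sum_n; apply HN; lia.
Qed.

Lemma sum_bounded_seq (u : nat -> R) (M : R) :
  (forall n, 0 <= u n) -> (forall N, Rsum u (seq 0 N) <= M) -> sum_bounded all_nat u M.
Proof.
  intros Hu HM F HN _; destruct (incl_seq F) as [N HF].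
  eapply Rle_trans; [|apply (HM N)].
  apply Rsum_incl_le; auto.
Qed.

Lemma seq_0_S (N : nat) : seq 0 (S N) = O :: map S (seq 0 N).
Proof. simpl; f_equal; symmetry; apply seq_shift. Qed.

(** * Absolutely convergent series *)

(** M is any bound for the sums of moduli, not their limit: it is the explicit quantity that the
    lattice estimate needs later. *)
Definition is_abs_series (f : nat -> C) (l : C) (M : R) : Prop :=
  (forall N, Rsum (fun n => Cmod (f n)) (seq 0 N) <= M) /\
  is_lim_seq (fun N => Cmod (Csum f (seq 0 N) - l)) 0.

(** The bound gives some unordered sum [l']; along initial segments the partial sums approach both l
    and [l'], which must agree. *)
Lemma is_abs_series_is_usum (f : nat -> C) (l : C) (M : R) :
  is_abs_series f l M -> is_usum all_nat f l.
Proof.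
  intros [HM Hl].
  destruct (ex_usum_bounded all_nat f M) as [l' Hl'].
  { apply sum_bounded_seq; [intros; apply Cmod_ge_0 | exact HM]. }
  enough (E : l = l') by (rewrite E; exact Hl').
  apply NNPP; intros Hne.
  assert (Hd : 0 < Cmod (l - l')).
  { apply Cmod_gt_0; intros E; apply Hne.
    replace l with (l - l' + l')%C by ring; rewrite E; ring. }
  set (d := Cmod (l - l')) in Hd.
  assert (H1 := finite_subsets_seq _
    (proj1 (is_usum_Cmod _ _ _) Hl' (d / 2) ltac:(lra))).
  apply is_lim_seq_spec in Hl; assert (H2 := Hl (pos_div_2 (mkposreal d Hd))).
  destruct (filter_ex _ (filter_and _ _ H1 H2)) as [N [HN1 HN2]].
  simpl in HN1, HN2.
  rewrite Rminus_0_r, Rabs_right in HN2 by (apply Rle_ge, Cmod_ge_0).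
  enough (d < d) by lra.
  unfold d at 1.
  replace (l - l')%C with
    (- (Csum f (seq 0 N) - l) + (Csum f (seq 0 N) - l'))%C by ring.
  eapply Rle_lt_trans; [apply Cmod_triangle | rewrite Cmod_opp; lra].
Qed.

Lemma is_lim_seq_0_le (u v : nat -> R) :
  (forall n, 0 <= u n <= v n) -> is_lim_seq v 0 -> is_lim_seq u 0.
Proof.
  intros H; apply is_lim_seq_le_le with (u := fun _ => 0); [exact H|].
  apply is_lim_seq_const.
Qed.

Lemma is_abs_series_ext (f g : nat -> C) (l : C) (M : R) :
  (forall n, f n = g n) -> is_abs_series f l M -> is_abs_series g l M.
Proof.
  intros E; replace g with f by (apply functional_extensionality, E); auto.
Qed.

Lemma is_abs_series_mult_l (c : C) (f : nat -> C) (l : C) (M : R) :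
  is_abs_series f l M ->
  is_abs_series (fun n => c * f n)%C (c * l)%C (Cmod c * M).
Proof.
  intros [HM Hl]; split.
  - intros N.
    replace (fun n => Cmod (c * f n)) with (fun n => Cmod c * Cmod (f n))
      by (apply functional_extensionality; intros; symmetry; apply Cmod_mult).
    rewrite Rsum_mult_l; apply Rmult_le_compat_l; [apply Cmod_ge_0 | apply HM].
  - apply is_lim_seq_ext with (fun N => Cmod c * Cmod (Csum f (seq 0 N) - l)).
    + intros N; rewrite <- Cmod_mult, Csum_mult_l; f_equal; ring.
    + replace (Finite 0) with (Rbar_mult (Cmod c) 0) by (simpl; f_equal; ring).
      apply is_lim_seq_scal_l, Hl.
Qed.

Lemma is_abs_series_plus (f g : nat -> C) (l l' : C) (M M' : R) :
  is_abs_series f l M -> is_abs_series g l' M' ->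
  is_abs_series (fun n => f n + g n)%C (l + l')%C (M + M').
Proof.
  intros [HM Hl] [HM' Hl']; split.
  - intros N; eapply Rle_trans.
    + apply (Rsum_le (fun _ => True) _ (fun n => Cmod (f n) + Cmod (g n))).
      * intros n _; apply Cmod_triangle.
      * apply List.Forall_forall; auto.
    + rewrite Rsum_plus; apply Rplus_le_compat; auto.
  - refine (is_lim_seq_0_le _
      (fun N => Cmod (Csum f (seq 0 N) - l) + Cmod (Csum g (seq 0 N) - l')) _ _).
    + intros N; split; [apply Cmod_ge_0|].
      rewrite Csum_plus.
      replace (Csum f (seq 0 N) + Csum g (seq 0 N) - (l + l'))%C with
        ((Csum f (seq 0 N) - l) + (Csum g (seq 0 N) - l'))%C by ring.
      apply Cmod_triangle.
    + replace (Finite 0) with (Finite (0 + 0)) by (f_equal; ring).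
      apply is_lim_seq_plus'; assumption.
Qed.

Lemma is_abs_series_shift (f : nat -> C) (l : C) (M : R) :
  f O = RtoC 0 -> is_abs_series (fun n => f (S n)) l M -> is_abs_series f l M.
Proof.
  intros H0 [HM Hl]; split.
  - intros [|N].
    + exact (HM O).
    + rewrite seq_0_S; simpl; rewrite H0, Cmod_0, Rsum_map, Rplus_0_l; apply HM.
  - apply is_lim_seq_incr_1; refine (is_lim_seq_ext _ _ _ _ Hl).
    intros N; rewrite seq_0_S; simpl; rewrite H0, Csum_map, Cplus_0_l; reflexivity.
Qed.

Lemma Rsum_exp_le (x : R) (N : nat) :
  0 <= x -> Rsum (fun n => x ^ n / INR (fact n)) (seq 0 N) <= exp x.
Proof.
  intros Hx; destruct N as [|N]; [left; apply exp_pos|].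
  eapply Rle_trans; [|apply (exp_ge_taylor x N Hx)].
  apply Req_le; induction N as [|N IH]; [simpl; ring|].
  rewrite seq_S, Rsum_app, IH; simpl; ring.
Qed.

Lemma RtoC_fact_neq_0 (n : nat) : RtoC (INR (fact n)) <> RtoC 0.
Proof. intros H; apply RtoC_inj in H; revert H; apply INR_fact_neq_0. Qed.

Lemma Cmod_pow_div_fact (z : C) (n : nat) :
  Cmod (z ^ n / RtoC (INR (fact n))) = Cmod z ^ n / INR (fact n).
Proof.
  rewrite Cmod_div by apply RtoC_fact_neq_0.
  rewrite Cmod_pow, Cmod_R, Rabs_right; [reflexivity|].
  apply Rle_ge, pos_INR.
Qed.

(** Differentiation lowers the degree by one, so [S N] terms become z times the first [N] terms. *)
Lemma is_Cderive_exp_partial (z : C) (N : nat) (t : R) :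
  is_Cderive (fun s => Csum (fun n => (RtoC s * z) ^ n / RtoC (INR (fact n)))%C
                         (seq 0 (S N))) t
    (z * Csum (fun n => (RtoC t * z) ^ n / RtoC (INR (fact n)))%C (seq 0 N))%C.
Proof.
  induction N as [|N IH].
  - simpl seq; unfold Csum, fold_right.
    replace (z * 0)%C with (RtoC 0) by ring.
    exact (is_Cderive_const (1 / 1 + 0)%C t).
  - assert (Hpow : forall n, is_Cderive (fun s => (RtoC s * z) ^ n)%C t
        (RtoC (INR n) * (RtoC t * z) ^ pred n * z)%C).
    { induction n as [|n IHn].
      - replace (RtoC (INR 0) * _ * z)%C with (RtoC 0) by (simpl; ring).
        exact (is_Cderive_const (RtoC 1) t).
      - refine (is_Cderive_eq _ _ _ _
          (is_Cderive_mult _ _ _ _ _ (is_Cderive_scal z t) IHn) _).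
        rewrite S_INR, RtoC_plus; destruct n; simpl; ring. }
    assert (H := is_Cderive_plus _ _ _ _ _ IH
      (is_Cderive_mult _ _ _ _ _ (Hpow (S N))
         (is_Cderive_const (/ RtoC (INR (fact (S N))))%C t))).
    rewrite Csum_seq_S.
    replace (fun s : R => Csum (fun n => (RtoC s * z) ^ n / RtoC (INR (fact n)))%C
                            (seq 0 (S (S N)))) with
      (fun s : R => Csum (fun n => (RtoC s * z) ^ n / RtoC (INR (fact n)))%C
                      (seq 0 (S N)) +
              (RtoC s * z) ^ (S N) * / RtoC (INR (fact (S N))))%C
      by (apply functional_extensionality; intros s;
          rewrite (Csum_seq_S _ (S N)); reflexivity).
    refine (is_Cderive_eq _ _ _ _ H _).
    simpl pred.
    rewrite fact_simpl, mult_INR, RtoC_mult; field; split.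
    + apply RtoC_fact_neq_0.
    + intros E; apply RtoC_inj in E; revert E; apply not_0_INR; lia.
Qed.

(* [exp (-t z)] times the [N]-th Taylor polynomial of [exp (t z)] has derivative
   [- z exp (-t z) (t z)^N / N!], so it varies little on [[0, 1]]. *)
Lemma Cexp_taylor_remainder (z : C) (N : nat) :
  Cmod (Csum (fun n => z ^ n / RtoC (INR (fact n)))%C (seq 0 (S N)) - Cexp z) <=
  2 * Cmod z * exp (Cmod z) ^ 2 * (Cmod z ^ N / INR (fact N)).
Proof.
  set (P := fun K (t : R) =>
    Csum (fun n => (RtoC t * z) ^ n / RtoC (INR (fact n)))%C (seq 0 K)).
  set (D := fun t : R => (Cexp (RtoC t * - z) * P (S N) t)%C).
  assert (HD : forall t, is_Cderive D t
    (- z * Cexp (RtoC t * - z) * ((RtoC t * z) ^ N / RtoC (INR (fact N))))%C).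
  { intros t.
    assert (H1 := is_Cderive_scal (- z)%C t).
    assert (H := is_Cderive_mult _ _ _ _ _ (is_Cderive_exp _ _ _ H1)
      (is_Cderive_exp_partial z N t)).
    refine (is_Cderive_eq _ _ _ _ H _).
    unfold P; rewrite Csum_seq_S; ring. }
  assert (Hz := Cmod_ge_0 z).
  assert (HB := Cmean_value_le D _ (Cmod z * exp (Cmod z) * (Cmod z ^ N / INR (fact N))) HD).
  assert (HP : P (S N) 1 =
      Csum (fun n => z ^ n / RtoC (INR (fact n)))%C (seq 0 (S N))).
  { unfold P; f_equal; apply functional_extensionality; intros n.
    rewrite Cmult_1_l; reflexivity. }
  assert (H0 : D 0 = RtoC 1).
  { unfold D, P; rewrite seq_0_S; simpl Csum; rewrite Csum_map.
    rewrite (Csum_ext_Forall (fun _ => True) _ (fun _ => RtoC 0 * RtoC 0)%C).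
    - rewrite Csum_mult_l, !Cmult_0_l, Cexp_RtoC, exp_0; simpl; field.
    - intros n _; rewrite !Cmult_0_l; simpl; unfold Cdiv; ring.
    - apply List.Forall_forall; auto. }
  rewrite <- HP.
  (* Here [D 0 = 1]. One factor exp |z| of the bound comes from this [Cexp z], the other from exp
     (-t z) in the derivative of [D]. *)
  replace (P (S N) 1 - Cexp z)%C with (Cexp z * (D 1 - D 0))%C.
  - rewrite Cmod_mult.
    assert (He := Cmod_Cexp_le z); assert (Hp := exp_pos (Cmod z)).
    apply Rle_trans with (exp (Cmod z) * (2 *
      (Cmod z * exp (Cmod z) * (Cmod z ^ N / INR (fact N))))); [|apply Req_le; ring].
    apply Rmult_le_compat; try apply Cmod_ge_0; [exact He|].
    apply HB; intros t Ht.
    assert (Htz : Cmod (RtoC t * z) <= Cmod z).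
    { rewrite Cmod_mult, Cmod_R, Rabs_right by lra; nra. }
    rewrite !Cmod_mult, Cmod_opp, Cmod_pow_div_fact.
    apply Rmult_le_compat.
    + apply Rmult_le_pos; apply Cmod_ge_0.
    + apply Rmult_le_pos; [apply pow_le, Cmod_ge_0|].
      left; apply Rinv_0_lt_compat, INR_fact_lt_0.
    + apply Rmult_le_compat_l; [exact Hz|].
      eapply Rle_trans; [apply Cmod_Cexp_le|].
      replace (RtoC t * - z)%C with (- (RtoC t * z))%C by ring; rewrite Cmod_opp.
      apply exp_le, Htz.
    + apply Rmult_le_compat_r; [left; apply Rinv_0_lt_compat, INR_fact_lt_0|].
      apply pow_incr; split; [apply Cmod_ge_0 | exact Htz].
  - rewrite H0; unfold D.
    replace (RtoC 1 * - z)%C with (- z)%C by ring.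
    assert (E : (Cexp z * Cexp (- z))%C = RtoC 1).
    { rewrite <- Cexp_plus; replace (z + - z)%C with (RtoC 0) by ring.
      rewrite Cexp_RtoC, exp_0; reflexivity. }
    replace (Cexp z * (Cexp (- z) * P (S N) 1 - RtoC 1))%C with
      (Cexp z * Cexp (- z) * P (S N) 1 - Cexp z)%C by ring.
    rewrite E; ring.
Qed.

Lemma is_abs_series_exp (z : C) :
  is_abs_series (fun n => z ^ n / RtoC (INR (fact n)))%C (Cexp z) (exp (Cmod z)).
Proof.
  split.
  - intros N.
    replace (fun n => Cmod (z ^ n / RtoC (INR (fact n))))
      with (fun n => Cmod z ^ n / INR (fact n))
      by (apply functional_extensionality; intros; symmetry; apply Cmod_pow_div_fact).
    apply Rsum_exp_le, Cmod_ge_0.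
  - apply is_lim_seq_incr_1; eapply is_lim_seq_0_le.
    + intros N; split; [apply Cmod_ge_0 | apply Cexp_taylor_remainder].
    + match goal with |- is_lim_seq (fun N => ?c * _) _ =>
        replace (Finite 0) with (Rbar_mult c 0) by (simpl; f_equal; ring) end.
      apply is_lim_seq_scal_l, is_lim_seq_Reals, cv_speed_pow_fact.
Qed.

(** * Generating function of the Hermite polynomials *)

Lemma hpoly_generating_n (nu : R) (a z : C) (m : nat) :
  0 <= nu ->
  is_abs_series (fun n => hpoly nu m n z * (a ^ n / RtoC (INR (fact n))))%C
    ((RtoC nu * z - RtoC nu * a) ^ m * Cexp (RtoC nu * (a * Cconj z)))%C
    ((nu * Cmod z + nu * Cmod a) ^ m * exp (nu * Cmod a * Cmod z)).
Proof.
  intros Hnu; induction m as [|m IH].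
  - assert (H := is_abs_series_exp (RtoC nu * (a * Cconj z))).
    rewrite !Cmod_mult, Cmod_conj, Cmod_R, (Rabs_right nu) in H by lra.
    simpl pow; simpl Cpow; rewrite Cmult_1_l, Rmult_1_l, Rmult_assoc.
    refine (is_abs_series_ext _ _ _ _ _ H); intros n; simpl hpoly; unfold Cdiv.
    rewrite !Cpow_mult_l; ring.
  - set (f := fun n => (hpoly nu m n z * (a ^ n / RtoC (INR (fact n))))%C) in IH.
    (* [s] is [f] delayed by one place: n H_{m,n-1} a^n / n! equals a times the term of index n - 1,
       and vanishes at n = 0. The second part of the recursion thus multiplies the sum by - nu a. *)
    set (s := fun n => match n with O => RtoC 0 | S k => f k end).
    assert (Hs := is_abs_series_shift s _ _ eq_refl IH).
    assert (H := is_abs_series_plus _ _ _ _ _ _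
      (is_abs_series_mult_l (RtoC nu * z) _ _ _ IH)
      (is_abs_series_mult_l (- (RtoC nu * a)) _ _ _ Hs)).
    rewrite Cmod_opp, !Cmod_mult, Cmod_R, (Rabs_right nu) in H by lra.
    match goal with |- is_abs_series _ ?l ?M => match type of H with
      is_abs_series _ ?l' ?M' =>
        replace l with l' by (simpl; ring); replace M with M' by (simpl; ring) end end.
    refine (is_abs_series_ext _ _ _ _ _ H).
    intros [|n]; unfold s, f; cbn [hpoly Nat.pred]; [simpl; unfold Cdiv; ring|].
    rewrite fact_simpl, mult_INR, RtoC_mult, Cpow_S.
    assert (Hn : RtoC (INR (S n)) <> RtoC 0)
      by (intros E; apply RtoC_inj in E; revert E; apply not_0_INR; lia).
    assert (Hf := RtoC_fact_neq_0 n).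
    revert Hn; generalize (RtoC (INR (S n))); intros k Hk. field; auto.
Qed.

(** The row bounds form again an exponential series in m, which gives an exponent affine in |z|,
    without |z|^2 term. *)
Lemma hpoly_generating (nu : R) (a b z : C) :
  0 <= nu ->
  let f := fun p : nat * nat =>
    (hpoly nu (fst p) (snd p) z * ((a ^ snd p * b ^ fst p) /
       RtoC (INR (fact (fst p)) * INR (fact (snd p)))))%C in
  sum_bounded (fun _ => True) (fun p => Cmod (f p))
    (exp (nu * Cmod a * Cmod z + nu * (Cmod z + Cmod a) * Cmod b)) /\
  is_usum (fun _ => True) f
    (Cexp (RtoC nu * (a * Cconj z + b * z - a * b))).
Proof.
  intros Hnu f.
  set (d := fun m => (b ^ m / RtoC (INR (fact m)))%C).
  assert (Hrow : forall m, is_abs_series (fun n => f (m, n))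
      (d m * ((RtoC nu * z - RtoC nu * a) ^ m * Cexp (RtoC nu * (a * Cconj z))))
      (Cmod (d m) * ((nu * Cmod z + nu * Cmod a) ^ m * exp (nu * Cmod a * Cmod z)))).
  { intros m.
    refine (is_abs_series_ext _ _ _ _ _
      (is_abs_series_mult_l (d m) _ _ _ (hpoly_generating_n nu a z m Hnu))).
    intros n; unfold f, d; simpl fst; simpl snd; rewrite RtoC_mult.
    field; split; apply RtoC_fact_neq_0. }
  set (E := exp (nu * Cmod a * Cmod z)) in Hrow.
  assert (HE : 0 < E) by apply exp_pos.
  assert (Hx : 0 <= (nu * Cmod z + nu * Cmod a) * Cmod b).
  { assert (H1 := Cmod_ge_0 z); assert (H2 := Cmod_ge_0 a); assert (H3 := Cmod_ge_0 b).
    apply Rmult_le_pos; [|exact H3].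
    apply Rplus_le_le_0_compat; apply Rmult_le_pos; assumption. }
  assert (HB : sum_bounded (set_prod all_nat all_nat) (fun p => Cmod (f p))
    (E * exp ((nu * Cmod z + nu * Cmod a) * Cmod b))).
  { apply sum_bounded_prod with
      (B := fun m => E * (((nu * Cmod z + nu * Cmod a) * Cmod b) ^ m / INR (fact m))).
    - intros p; apply Cmod_ge_0.
    - intros m _; apply sum_bounded_seq; [intros; apply Cmod_ge_0|].
      intros N; eapply Rle_trans; [apply (proj1 (Hrow m))|].
      apply Req_le; unfold d; rewrite Cmod_pow_div_fact, Rpow_mult_distr.
      unfold Rdiv; ring.
    - apply sum_bounded_mult_l; [lra|].
      apply sum_bounded_seq.
      + intros m; apply Rmult_le_pos; [apply pow_le, Hx|].
        left; apply Rinv_0_lt_compat, INR_fact_lt_0.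
      + intros N; apply Rsum_exp_le, Hx. }
  split.
  - intros F HN HF.
    replace (exp _) with (E * exp ((nu * Cmod z + nu * Cmod a) * Cmod b)).
    + apply HB; [exact HN|].
      apply List.Forall_forall; intros; split; exact Logic.I.
    + unfold E; rewrite <- exp_plus; f_equal; ring.
  (* The exchange gives an unidentified sum [L]; its value is found by summing the closed forms of
     the rows, a Taylor series of exp ((nu z - nu a) b) times exp (nu a conj z). *)
  - destruct (usum_exchange _ _ _ _ _ HB
      (fun m _ => is_abs_series_is_usum _ _ _ (Hrow m))) as [L [HL [HL' _]]].
    replace (Cexp _) with L.
    + refine (is_usum_set_ext _ _ _ _ _ HL).
      intros p; split; [|intros _; split]; intros; exact Logic.I.
    + rewrite <- (is_usum_unique _ _ _ HL'); apply is_usum_unique.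
      assert (H := is_usum_mult_l _ (Cexp (RtoC nu * (a * Cconj z))) _ _
        (is_abs_series_is_usum _ _ _
          (is_abs_series_exp ((RtoC nu * z - RtoC nu * a) * b)))).
      rewrite <- Cexp_plus in H.
      match goal with |- is_usum _ _ (Cexp ?l) => match type of H with
        is_usum _ _ (Cexp ?l') => replace l with l' by ring end end.
      refine (is_usum_ext _ _ _ _ _ H); intros m _; unfold d, Cdiv.
      rewrite Cpow_mult_l; ring.
Qed.

(** * Gaussian sums over a lattice *)

Lemma sum_bounded_geom (x : R) :
  0 <= x < 1 -> sum_bounded all_nat (fun n => x ^ n) (/ (1 - x)).
Proof.
  intros Hx; apply sum_bounded_seq; [intros; apply pow_le; lra|].
  intros N.
  assert (E : Rsum (fun n => x ^ n) (seq 0 N) = (1 - x ^ N) / (1 - x)).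
  { induction N as [|N IH]; [simpl; field; lra|].
    rewrite seq_S, Rsum_app, IH; simpl; field; lra. }
  assert (Hp := pow_le x N (proj1 Hx)).
  assert (Hi : 0 < / (1 - x)) by (apply Rinv_0_lt_compat; lra).
  rewrite E; unfold Rdiv; nra.
Qed.

(** The integers are covered by n and -n for natural n; counting 0 twice is harmless and gives twice
    the geometric bound. *)
Lemma sum_bounded_Z (x : R) :
  0 <= x < 1 -> sum_bounded (fun _ : Z => True) (fun p => x ^ Z.abs_nat p) (2 / (1 - x)).
Proof.
  intros Hx F HN _.
  set (G := map Z.abs_nat F).
  destruct (incl_seq G) as [N HG]; assert (HG' := HG N (le_n N)).
  apply Rle_trans with (Rsum (fun p => x ^ Z.abs_nat p)
    (map Z.of_nat (seq 0 N) ++ map (fun n => (- Z.of_nat n)%Z) (seq 0 N))).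
  - apply Rsum_incl_le; [intros; apply pow_le; lra | exact HN |].
    intros p Hp.
    assert (Hq := HG' _ (in_map Z.abs_nat _ _ Hp)); apply in_or_app.
    destruct (Z_le_dec 0 p); [left | right]; apply in_map_iff; exists (Z.abs_nat p);
      split; try exact Hq; lia.
  - rewrite Rsum_app, !Rsum_map.
    replace (fun i => x ^ Z.abs_nat (Z.of_nat i)) with (fun n => x ^ n)
      by (apply functional_extensionality; intros; f_equal; lia).
    replace (fun i => x ^ Z.abs_nat (- Z.of_nat i)) with (fun n => x ^ n)
      by (apply functional_extensionality; intros; f_equal; lia).
    assert (H := sum_bounded_geom x Hx (seq 0 N) (seq_NoDup _ _)
      (proj2 (List.Forall_forall _ _) (fun _ _ => Logic.I))).
    unfold Rdiv; lra.
Qed.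

(** Cramer's rule: with D the determinant of the two periods and z the combination, Im (z conj
    omega2) = a D and Im (z conj omega1) = - b D. *)
Lemma R_independent_coercive (omega1 omega2 : C) :
  R_independent omega1 omega2 ->
  exists K, 0 <= K /\ forall a b : R,
    Rabs a + Rabs b <= K * Cmod (RtoC a * omega1 + RtoC b * omega2).
Proof.
  intros Hind.
  set (D := Im (omega1 * Cconj omega2)).
  assert (HD : D <> 0).
  { intros HD; unfold D in HD; destruct omega1 as [x1 y1], omega2 as [x2 y2].
    assert (HD' : y1 * x2 - x1 * y2 = 0) by (simpl in HD; lra).
    (* |omega2|^2 omega1 - Re (omega1 conj omega2) omega2 equals i D omega2, which vanishes with D;
       independence then forces omega2 = 0, and the pair (0, 1) gives the contradiction. *)
    destruct (Hind (x2 * x2 + y2 * y2) (- (x1 * x2 + y1 * y2))) as [H1 _].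
    - apply injective_projections; simpl.
      + transitivity (- y2 * (y1 * x2 - x1 * y2)); [ring | rewrite HD'; ring].
      + transitivity (x2 * (y1 * x2 - x1 * y2)); [ring | rewrite HD'; ring].
    - assert (x2 = 0) by nra; assert (y2 = 0) by nra; subst.
      destruct (Hind 0 1) as [_ H2]; [|lra].
      apply injective_projections; simpl; ring. }
  assert (HDp := Rabs_pos_lt D HD).
  exists ((Cmod omega1 + Cmod omega2) / Rabs D); split.
  - assert (H1 := Cmod_ge_0 omega1); assert (H2 := Cmod_ge_0 omega2).
    apply Rdiv_le_0_compat; lra.
  - intros a b; set (z := (RtoC a * omega1 + RtoC b * omega2)%C).
    assert (Ha : Rabs a * Rabs D <= Cmod z * Cmod omega2).
    { rewrite <- Rabs_mult, <- (Cmod_conj omega2), <- Cmod_mult.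
      eapply Rle_trans; [|apply Im_le_Cmod]; apply Req_le; f_equal.
      unfold z, D; destruct omega1, omega2; simpl; ring. }
    assert (Hb : Rabs b * Rabs D <= Cmod z * Cmod omega1).
    { rewrite <- Rabs_mult, <- (Cmod_conj omega1), <- Cmod_mult, <- Rabs_Ropp.
      eapply Rle_trans; [|apply Im_le_Cmod]; apply Req_le; f_equal.
      unfold z, D; destruct omega1, omega2; simpl; ring. }
    apply Rmult_le_reg_r with (Rabs D); [exact HDp|].
    replace ((Cmod omega1 + Cmod omega2) / Rabs D * Cmod z * Rabs D)
      with ((Cmod omega1 + Cmod omega2) * Cmod z) by (field; lra).
    lra.
Qed.

(** Choosing one index pair per point lifts a duplicate-free list of lattice points to a
    duplicate-free list of pairs. *)
Lemma sum_bounded_lattice (omega1 omega2 : C) (u : C -> R) (M : R) :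
  sum_bounded (fun _ => True)
    (fun pq : Z * Z => u (RtoC (IZR (fst pq)) * omega1 + RtoC (IZR (snd pq)) * omega2)%C) M ->
  sum_bounded (lattice omega1 omega2) u M.
Proof.
  intros HM F HN HF.
  set (phi := fun pq : Z * Z =>
    (RtoC (IZR (fst pq)) * omega1 + RtoC (IZR (snd pq)) * omega2)%C) in HM.
  assert (HP : exists P, F = map phi P).
  { clear HN; induction HF as [|g F [p [q Hg]] _ [P ->]]; [exists nil; reflexivity|].
    exists ((p, q) :: P); simpl; rewrite Hg; reflexivity. }
  destruct HP as [P ->]; rewrite Rsum_map; apply HM.
  - exact (NoDup_map_inv _ _ HN).
  - apply List.Forall_forall; auto.
Qed.

(** A multiple K |g| is borrowed from the Gaussian; it dominates |p| + |q| by coercivity, leaving a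
    product of two geometric sums of ratio exp (-1). *)
Lemma lattice_gaussian_bounded (omega1 omega2 : C) (nu A : R) :
  R_independent omega1 omega2 -> 0 < nu ->
  exists M, sum_bounded (lattice omega1 omega2)
    (fun g => exp (- (nu / 2) * Cmod g ^ 2 + A * Cmod g)) M.
Proof.
  intros Hind Hnu.
  destruct (R_independent_coercive _ _ Hind) as [K [HK Hco]].
  set (x := exp (- (1))).
  assert (Hx : 0 <= x < 1).
  { split; [left; apply exp_pos|].
    rewrite <- exp_0; apply exp_increasing; lra. }
  assert (Hpow : forall p : Z, exp (- Rabs (IZR p)) = x ^ Z.abs_nat p).
  { intros p; rewrite <- abs_IZR, <- Zabs2Nat.id_abs, <- INR_IZR_INZ.
    generalize (Z.abs_nat p); intros n; unfold x.
    induction n as [|n IH]; [simpl; rewrite Ropp_0; apply exp_0|].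
    rewrite S_INR, Ropp_plus_distr, exp_plus, IH; simpl; ring. }
  (* The maximum over real r of exp (- nu/2 r^2 + (A + K) r), attained at r = (A + K) / nu. *)
  set (c := exp ((A + K) ^ 2 / (2 * nu))).
  exists (2 / (1 - x) * (c * (2 / (1 - x)))).
  apply sum_bounded_lattice.
  assert (HB : sum_bounded (set_prod (fun _ : Z => True) (fun _ : Z => True))
    (fun pq => c * x ^ Z.abs_nat (fst pq) * x ^ Z.abs_nat (snd pq))
    (2 / (1 - x) * (c * (2 / (1 - x))))).
  { assert (Hc : 0 < c) by apply exp_pos.
    apply sum_bounded_prod with
      (B := fun p => 2 / (1 - x) * (c * x ^ Z.abs_nat p)).
    - intros p; repeat apply Rmult_le_pos; try apply pow_le; lra.
    - intros p _; simpl.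
      rewrite (Rmult_comm (2 / (1 - x))).
      apply sum_bounded_mult_l; [apply Rmult_le_pos; [lra | apply pow_le; lra]|].
      apply sum_bounded_Z, Hx.
    - apply sum_bounded_mult_l; [apply Rdiv_le_0_compat; lra|].
      apply sum_bounded_mult_l; [lra|].
      apply sum_bounded_Z, Hx. }
  intros F HN HF.
  eapply Rle_trans; [|apply HB; [exact HN|]].
  - apply (Rsum_le (fun _ => True)); [|exact HF].
    intros [p q] _; simpl fst; simpl snd.
    set (g := (RtoC (IZR p) * omega1 + RtoC (IZR q) * omega2)%C).
    rewrite <- !Hpow; unfold c; rewrite <- !exp_plus; apply exp_le.
    assert (Hg := Hco (IZR p) (IZR q)); fold g in Hg.
    set (r := Cmod g) in *.
    enough (- (nu / 2) * r ^ 2 + (A + K) * r <= (A + K) ^ 2 / (2 * nu)) by lra.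
    replace ((A + K) ^ 2 / (2 * nu)) with
      (- (nu / 2) * r ^ 2 + (A + K) * r + nu / 2 * (r - (A + K) / nu) ^ 2)
      by (field; lra).
    assert (H := pow2_ge_0 (r - (A + K) / nu)); nra.
  - apply List.Forall_forall; intros; split; exact Logic.I.
Qed.

(** * The two expansions of the kernel *)

Theorem theorem2p3 (omega1 omega2 : C) (nu : R) (chi : C -> C)
    (Hindep : R_independent omega1 omega2)
    (Hnu : (0 < nu)%R)
    (Hchi : pseudo_character (lattice omega1 omega2) nu chi) :
  let Gamma := lattice omega1 omega2 in
  (forall z w : C, ex_usum Gamma (kernel_term nu chi z w)) /\
  (forall m n : nat, ex_usum Gamma (coeff_term nu chi m n)) /\
  (forall z w : C,
     ex_usum (fun _ : nat * nat => True) (expansion_term Gamma nu chi z w) /\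
     kernel Gamma nu chi z w =
       (RtoC (nu / PI) *
        usum (fun _ : nat * nat => True) (expansion_term Gamma nu chi z w))%C) /\
  (forall (m : nat) (z : C), ex_usum Gamma (theta_term nu chi (monomial m) z)) /\
  (forall z w : C,
     ex_Cseries (theta_expansion_term Gamma nu chi z w) /\
     kernel Gamma nu chi z w =
       (RtoC (nu / PI) * Cseries (theta_expansion_term Gamma nu chi z w))%C).
Proof.
  intros Gamma.
  set (weight := fun g => (chi g * RtoC (exp (- (nu / 2) * Cmod g ^ 2)))%C).
  assert (Hweight : forall g, Gamma g ->
      Cmod (weight g) = exp (- (nu / 2) * Cmod g ^ 2)).
  { intros g Hg; unfold weight; rewrite Cmod_mult, (proj1 Hchi g Hg), Cmod_R.
    rewrite Rabs_right, Rmult_1_l by (left; apply exp_pos); reflexivity. }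
  assert (Hkernel : forall z w g, kernel_term nu chi z w g =
      (weight g * Cexp (RtoC nu * (z * Cconj g - Cconj w * g + z * Cconj w)))%C).
  { intros z w g; unfold kernel_term, weight.
    rewrite Cexp_plus, Cexp_RtoC; ring. }
  (* Summability of [Gamma x T] families whose sums over [T] grow at most like
     [exp (A |g|)] once the Gaussian weight is factored out. *)
  assert (Hexch : forall (J : Type) (T : J -> Prop) (f : C * J -> C) (l : C -> C) (A B : R),
      (forall g, sum_bounded T (fun j => Cmod (f (g, j))) (exp (A * Cmod g + B))) ->
      (forall g, is_usum T (fun j => f (g, j)) (l g)) ->
      exists L, is_usum Gamma (fun g => weight g * l g)%C L /\
        (forall j, T j -> ex_usum Gamma (fun g => weight g * f (g, j))%C) /\
        is_usum T (fun j => usum Gamma (fun g => weight g * f (g, j))%C) L).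
  { intros J T f l A B Hb Hl.
    destruct (lattice_gaussian_bounded omega1 omega2 nu A Hindep Hnu) as [M HM].
    destruct (usum_exchange Gamma T (fun p => weight (fst p) * f p)%C
      (fun g => weight g * l g)%C (exp B * M)) as [L [_ HL]].
    - apply sum_bounded_prod with
        (B := fun g => Cmod (weight g) * exp (A * Cmod g + B)).
      + intros p; apply Cmod_ge_0.
      + intros g _; simpl fst.
        replace (fun j => Cmod (weight g * f (g, j))) with
          (fun j => Cmod (weight g) * Cmod (f (g, j)))
          by (apply functional_extensionality; intros; symmetry; apply Cmod_mult).
        apply sum_bounded_mult_l; [apply Cmod_ge_0 | apply Hb].
      + eapply sum_bounded_le; [|apply sum_bounded_mult_l; [|exact HM]].
        * intros g Hg; simpl; rewrite (Hweight g Hg), <- !exp_plus.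
          apply Req_le; f_equal; ring.
        * left; apply exp_pos.
    - intros g _; apply is_usum_mult_l, Hl.
    - exists L; exact HL. }
  (* The constants stay inside the lattice sums here; they are pulled out only once the coefficient
     sums are known to converge. *)
  assert (Hhermite : forall z w : C, exists L,
      is_usum Gamma (kernel_term nu chi z w) L /\
      (forall mn : nat * nat, ex_usum Gamma (fun g =>
         RtoC (-1) ^ fst mn * ((z ^ snd mn * Cconj w ^ fst mn) /
           RtoC (INR (fact (fst mn)) * INR (fact (snd mn)))) *
         coeff_term nu chi (fst mn) (snd mn) g)%C) /\
      is_usum (fun _ : nat * nat => True) (fun mn => usum Gamma (fun g =>
         RtoC (-1) ^ fst mn * ((z ^ snd mn * Cconj w ^ fst mn) /
           RtoC (INR (fact (fst mn)) * INR (fact (snd mn)))) *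
         coeff_term nu chi (fst mn) (snd mn) g)%C) L).
  { intros z w.
    destruct (Hexch (nat * nat)%type (fun _ => True)
      (fun q => hpoly nu (fst (snd q)) (snd (snd q)) (fst q) *
         ((z ^ snd (snd q) * (- Cconj w) ^ fst (snd q)) /
          RtoC (INR (fact (fst (snd q))) * INR (fact (snd (snd q))))))%C
      (fun g => Cexp (RtoC nu * (z * Cconj g + - Cconj w * g - z * - Cconj w)))
      (nu * Cmod z + nu * Cmod w) (nu * Cmod z * Cmod w)) as [L [H1 [H2 H3]]].
    - intros g.
      assert (H := proj1 (hpoly_generating nu z (- Cconj w) g (Rlt_le _ _ Hnu))).
      rewrite Cmod_opp, Cmod_conj in H.
      match goal with |- sum_bounded _ _ (exp ?x) => match type of H with
        sum_bounded _ _ (exp ?y) => replace x with y by ring end end.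
      exact H.
    - intros g; exact (proj2 (hpoly_generating nu z (- Cconj w) g (Rlt_le _ _ Hnu))).
    - assert (E : forall mn : nat * nat,
        (fun g => weight g * (hpoly nu (fst mn) (snd mn) g *
           ((z ^ snd mn * (- Cconj w) ^ fst mn) /
             RtoC (INR (fact (fst mn)) * INR (fact (snd mn))))))%C =
        (fun g => RtoC (-1) ^ fst mn * ((z ^ snd mn * Cconj w ^ fst mn) /
           RtoC (INR (fact (fst mn)) * INR (fact (snd mn)))) *
         coeff_term nu chi (fst mn) (snd mn) g)%C).
      { intros mn; apply functional_extensionality; intros g.
        unfold coeff_term, weight; rewrite hermite_hpoly.
        (* The m-th power of this factor produces the sign (-1)^m of the expansion. *)
        replace (- Cconj w)%C with (RtoC (-1) * Cconj w)%C
          by (apply injective_projections; simpl; ring).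
        rewrite Cpow_mult_l; unfold Cdiv; ring. }
      exists L; split; [|split].
      + refine (is_usum_ext _ _ _ _ _ H1); intros g _; rewrite Hkernel.
        do 3 f_equal; ring.
      + intros mn; rewrite <- E; exact (H2 mn Logic.I).
      + refine (is_usum_ext _ _ _ _ _ H3); intros mn _; rewrite <- E; reflexivity. }
  assert (Htheta : forall z w : C, exists L,
      is_usum Gamma (kernel_term nu chi z w) L /\
      (forall m, ex_usum Gamma (fun g =>
         (RtoC nu * Cconj w) ^ m / RtoC (INR (fact m)) *
         theta_term nu chi (monomial m) z g)%C) /\
      is_usum all_nat (fun m => usum Gamma (fun g =>
         (RtoC nu * Cconj w) ^ m / RtoC (INR (fact m)) *
         theta_term nu chi (monomial m) z g)%C) L).
  { intros z w.
    destruct (Hexch nat all_nat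
      (fun q => Cexp (RtoC nu * (z * Cconj (fst q))) *
         ((RtoC nu * Cconj w * (z - fst q)) ^ snd q / RtoC (INR (fact (snd q)))))%C
      (fun g => Cexp (RtoC nu * (z * Cconj g)) * Cexp (RtoC nu * Cconj w * (z - g)))%C
      (nu * Cmod z + nu * Cmod w) (nu * Cmod w * Cmod z)) as [L [H1 [H2 H3]]].
    - intros g.
      assert (H := is_abs_series_mult_l (Cexp (RtoC nu * (z * Cconj g))) _ _ _
        (is_abs_series_exp (RtoC nu * Cconj w * (z - g)))).
      apply sum_bounded_seq; [intros; apply Cmod_ge_0|].
      intros N; eapply Rle_trans; [exact (proj1 H N)|].
      eapply Rle_trans.
      { apply Rmult_le_compat_r; [left; apply exp_pos | apply Cmod_Cexp_le]. }
      rewrite <- exp_plus; apply exp_le.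
      rewrite !Cmod_mult, !Cmod_conj, Cmod_R, (Rabs_right nu) by lra.
      (* |z - g| <= |z| + |g| splits nu |w| |z - g|: the part in |g| joins nu |z| |g| in the slope,
         and nu |w| |z| is the constant. *)
      assert (Ht := Cmod_triangle z (- g)); rewrite Cmod_opp in Ht.
      apply (Rmult_le_compat_l (nu * Cmod w)) in Ht;
        [|apply Rmult_le_pos; [lra | apply Cmod_ge_0]].
      unfold Cminus; lra.
    - intros g; exact (is_abs_series_is_usum _ _ _ (is_abs_series_mult_l _ _ _ _
        (is_abs_series_exp (RtoC nu * Cconj w * (z - g))))).
    - assert (E : forall m, (fun g => weight g * (Cexp (RtoC nu * (z * Cconj g)) *
          ((RtoC nu * Cconj w * (z - g)) ^ m / RtoC (INR (fact m)))))%C =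
        (fun g => (RtoC nu * Cconj w) ^ m / RtoC (INR (fact m)) *
         theta_term nu chi (monomial m) z g)%C).
      { intros m; apply functional_extensionality; intros g.
        unfold theta_term, weight, monomial.
        rewrite Cexp_plus, Cexp_RtoC, (Cpow_mult_l (RtoC nu * Cconj w)).
        unfold Cdiv; ring. }
      exists L; split; [|split].
      + refine (is_usum_ext _ _ _ _ _ H1); intros g _.
        rewrite Hkernel, <- Cexp_plus; do 2 f_equal; ring.
      + intros m; rewrite <- E; exact (H2 m Logic.I).
      + refine (is_usum_ext _ _ _ _ _ H3); intros m _; rewrite <- E; reflexivity. }
  assert (Hcoeff : forall m n, ex_usum Gamma (coeff_term nu chi m n)).
  { intros m n; destruct (Hhermite (RtoC 1) (RtoC 1)) as [L [_ [H _]]].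
    refine (ex_usum_mult_l_inv _ _ _ _ (H (m, n))); simpl fst; simpl snd.
    replace (Cconj 1) with (RtoC 1) by (apply injective_projections; simpl; ring).
    rewrite !Cpow_1_l, RtoC_mult, Cmult_1_l; unfold Cdiv; rewrite Cmult_1_l.
    apply Cmult_neq_0.
    - apply Cpow_nz; intros E; apply RtoC_inj in E; lra.
    - apply Cinv_neq_0, Cmult_neq_0; apply RtoC_fact_neq_0. }
  assert (Hthetaex : forall m z, ex_usum Gamma (theta_term nu chi (monomial m) z)).
  { intros m z; destruct (Htheta z (RtoC 1)) as [L [_ [H _]]].
    refine (ex_usum_mult_l_inv _ _ _ _ (H m)).
    replace (Cconj 1) with (RtoC 1) by (apply injective_projections; simpl; ring).
    rewrite Cmult_1_r; apply Cmult_neq_0.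
    - apply Cpow_nz; intros E; apply RtoC_inj in E; lra.
    - apply Cinv_neq_0, RtoC_fact_neq_0. }
  split; [|split; [exact Hcoeff | split; [|split; [exact Hthetaex|]]]].
  - intros z w; destruct (Hhermite z w) as [L [H _]]; exists L; exact H.
  - intros z w; destruct (Hhermite z w) as [L [H1 [_ H2]]].
    assert (H3 : is_usum (fun _ : nat * nat => True)
                   (expansion_term Gamma nu chi z w) L).
    { refine (is_usum_ext _ _ _ _ _ H2); intros mn _.
      rewrite usum_mult_l by apply Hcoeff.
      unfold expansion_term, coeff; ring. }
    split; [exists L; exact H3|].
    unfold kernel; rewrite (is_usum_unique _ _ _ H1), (is_usum_unique _ _ _ H3).
    reflexivity.
  - intros z w; destruct (Htheta z w) as [L [H1 [_ H2]]].
    assert (H3 : is_series (V := C_R_NormedModule)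
                   (theta_expansion_term Gamma nu chi z w) L).
    (* The exchange yields an unordered sum over m, which is stronger than the ordered series
       claimed. *)
    { apply is_usum_is_series; refine (is_usum_ext _ _ _ _ _ H2); intros m _.
      rewrite usum_mult_l by apply Hthetaex.
      unfold theta_expansion_term, theta_op; ring. }
    split; [exists L; exact H3|].
    unfold kernel; rewrite (is_usum_unique _ _ _ H1); f_equal; symmetry.
    exact (iota_filterlim_locally (V := C_R_CompleteNormedModule) _ L H3).
Qed.
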